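(* Fix an integer $k \geq 3$. Then there exists $\ell_0$ (depending on $k$) such that for all integers $\ell \geq \ell_0$, the maximum size of a partially $2$-intersecting set of $(k,\ell)$-partitions is \[ \binom{k\ell-2}{k-2}\, u_{k,\ell-1}. \]
   Context: For positive integers $k,\ell$, a $(k,\ell)$-partition is a set partition of $\{1,2,\dots,k\ell\}$ with exactly $\ell$ blocks, each of size $k$. $\mathcal{U}_{k,\ell}$ denotes the set of all $(k,\ell)$-partitions and $u_{k,\ell}=|\mathcal{U}_{k,\ell}| = \frac{1}{\ell!}\binom{k\ell}{k}\binom{k\ell-k}{k}\cdots\binom{k}{k}$. Two $(k,\ell)$-partitions $P$ and $Q$ are partially $2$-intersecting if there exist a block $P_i$ of $P$ and a block $Q_j$ of $Q$ with $|P_i\cap Q_j|\geq 2$. A set of $(k,\ell)$-partitions is a partially $2$-intersecting set if any two partitions in the set are partially $2$-intersecting. *)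

(* Defs.v *)
From mathcomp Require Import all_boot.

Set Implicit Arguments.
Unset Strict Implicit.
Unset Printing Implicit Defensive.

(* The ground set {1, ..., kl} is represented by 'I_(k * l) = {0, ..., kl - 1}. *)
Definition is_kl_partition (k l : nat) (P : {set {set 'I_(k * l)}}) : bool :=
  [&& partition P [set: 'I_(k * l)], #|P| == l & [forall B in P, #|B| == k]].

Definition kl_partitions (k l : nat) : {set {set {set 'I_(k * l)}}} :=
  [set P | is_kl_partition P].

Definition num_kl_partitions (k l : nat) : nat := #|kl_partitions k l|.

Definition partially_2_intersecting (T : finType) (P Q : {set {set T}}) : bool :=
  [exists B in P, exists C in Q, 2 <= #|B :&: C|].

(* "Any two" includes a partition paired with itself; this is no restriction
   when k >= 2 and l >= 1, since a block meets itself in k elements. *)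
Definition partially_2_intersecting_set (k l : nat)
    (F : {set {set {set 'I_(k * l)}}}) : bool :=
  (F \subset kl_partitions k l)
  && [forall P in F, forall Q in F, partially_2_intersecting P Q].

(* Main.v *)
(* Write [n = k * l], let [A] be the graph on (k,l)-partitions joining partitions
   that have no pair of points together in both, and let [d] be its degree.  An
   intersecting set is a coclique of [A], so by the ratio bound it suffices that
   the least eigenvalue of [A] is [- e] with [e * (n - k) = d * (k - 1)].

   Every eigenspace is invariant under the symmetric group.  Let [D_ab g] be [g]
   minus its translate by the transposition [(a b)].
   - If [D_ab (D_cd (D_uv g)) <> 0] for some [g] in the eigenspace of [c] and some
     disjoint transpositions, then restricting to the group generated by about
     [l] disjoint transpositions yields of order [l ^ 3] distinct weights in the
     eigenspace, so [l ^ 3 * c ^ 2] is at most a constant times [tr (A ^ 2) = d * N],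
     [N] the number of partitions.  Since [N <= C(k) * d], this gives
     [|c| <= e] for [l] large.
   - Otherwise either [g] is constant, and [c = d], or some [D_ab (D_uv g)] is a
     nonzero function of the pattern induced on [a, b, u, v] only, which must be a
     multiple of [x_au - x_bu - x_av + x_bv], where [x_ij] is the indicator of
     [i] and [j] being together; then [c = - e].

   [N <= C(k) * d] is a switching argument: on average two partitions share a
   bounded number of pairs, and a pair can be destroyed by a transposition in a
   positive proportion of the possible ways. *)
Require Import Defs.
From HB Require Import structures.
From mathcomp Require Import all_boot all_order all_fingroup all_algebra all_field.
From mathcomp Require Import zify ring.

Set Implicit Arguments.
Unset Strict Implicit.
Unset Printing Implicit Defensive.

(** * Uniform partitions and the action of the symmetric group *)

(** If [s] moves [u], then [s * tperm u (s u)] fixes [u] and every point that [s] fixes, so the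
    number of moved points drops. *)
Lemma perm_on_tperm_ind (T : finType) (A : {set T}) (K : {perm T} -> Prop) :
  K 1%g ->
  (forall s u v, u \in A -> v \in A -> K s -> K (s * tperm u v)%g) ->
  forall s, perm_on A s -> K s.
Proof.
move=> K1 KM s; have [n] := ubnP #|[set u | s u != u]|.
elim: n s => // n IHn s /ltnSE le_n As.
have [s0|[u]] := set_0Vmem [set u | s u != u].
  suff -> : s = 1%g by []; apply/permP=> u; rewrite perm1.
  by have := in_set0 u; rewrite -s0 inE => /negbT; rewrite negbK => /eqP.
rewrite inE => su.
have Au : u \in A by apply: contraR su => /(out_perm As) ->.
have Asu : s u \in A by rewrite (perm_closed _ As).
have -> : s = (s * tperm u (s u) * tperm u (s u))%g by rewrite -mulgA tperm2 mulg1.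
apply: KM => //; apply: IHn; last first.
  apply: perm_onM => //; apply/subsetP=> v; rewrite inE.
  by case: tpermP => [->|->|]; rewrite ?Au ?Asu ?eqxx.
apply: leq_trans le_n; apply: proper_card; apply/properP; split.
  apply/subsetP=> v; rewrite !inE permM; apply: contraNneq => sv.
  rewrite sv tpermD //; apply: contraNneq su => uv; first by rewrite uv sv.
  by apply/eqP/(@perm_inj _ s); rewrite uv.
by exists u; rewrite !inE ?su // permM tpermR eqxx.
Qed.

Lemma perm_map_uniq (T : finType) (s t : seq T) :
  uniq s -> uniq t -> size s = size t -> exists p : {perm T}, map p s = t.
Proof.
elim: s t => [|u s IHs] [|v t] //=; first by exists 1%g.
move=> /andP[us Us] /andP[vt Ut] [/(IHs _ Us Ut)[p pst]].
exists (p * tperm (p u) v)%g; rewrite permM tpermL; congr cons.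
rewrite -[RHS]pst; apply/eq_in_map => w ws; rewrite permM tpermD //.
  by rewrite (inj_eq perm_inj); apply: contraNneq us => ->.
by apply: contraNneq vt => ->; rewrite -pst map_f.
Qed.

(** On [D] the function [f] factors through [g]; the factor [h] is option-valued because only the
    values of [g] on [D] determine it. *)
Lemma leq_card_imset_ker (I : finType) (U V : finType) (D : {set I})
    (f : I -> U) (g : I -> V) :
  {in D &, forall i j, g i = g j -> f i = f j} -> #|f @: D| <= #|g @: D|.
Proof.
move=> fg; pose h v := [pick u | u \in f @: D & [exists i in D, (g i == v) && (f i == u)]].
have hE i : i \in D -> h (g i) = Some (f i).
  move=> Di; rewrite /h; case: pickP => [u /andP[_ /exists_inP[j Dj /andP[/eqP gj /eqP <-]]]|].
    by rewrite (fg j i).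
  move/(_ (f i)); rewrite imset_f //= => /exists_inP[]; exists i => //.
  by rewrite !eqxx.
rewrite -(card_imset _ (@Some_inj _)); apply: leq_trans (leq_imset_card h _).
apply/subset_leq_card/subsetP => _ /imsetP[_ /imsetP[i Di ->] ->].
by rewrite -hE // imset_f // imset_f.
Qed.

Lemma bij_card_set (U V : finType) (A : {set U}) (B : {set V}) (f : U -> V) (g : V -> U) :
  {in A, forall x, f x \in B} -> {in B, forall y, g y \in A} ->
  {in A, cancel f g} -> {in B, cancel g f} -> #|A| = #|B|.
Proof.
move=> fB gA fK gK.
have -> : B = f @: A.
  apply/setP=> y; apply/idP/imsetP => [By|[x Ax ->]]; last exact: fB.
  by exists (g y); rewrite ?gA ?gK.
by rewrite card_in_imset //; apply: can_in_inj fK.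
Qed.

Definition kparts (T : finType) (k : nat) : {set {set {set T}}} :=
  [set P | partition P [set: T] && [forall B in P, #|B| == k]].

(** The number of blocks is left implicit, being forced by [#|T|] and [k]. A finite type lets the
    partitions serve as vertices and as summation indices. *)
Definition kpart (T : finType) (k : nat) := {P : {set {set T}} | P \in kparts T k}.

HB.instance Definition _ T k := SubFinite.on (kpart T k).

Section KPart.
Variables (T : finType) (k : nat).
Local Notation X := (kpart T k).
Implicit Types (x y z : X) (s t : {perm T}).

Definition same (x : X) (i j : T) : bool := j \in pblock (val x) i.

Lemma kpart_partition x : partition (val x) [set: T].
Proof. by have := valP x; rewrite inE => /andP[]. Qed.

Lemma kpart_uniform x B : B \in val x -> #|B| = k.
Proof. by have := valP x; rewrite inE => /andP[_ /forall_inP xk] /xk/eqP. Qed.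

Lemma kpart_cover x i : i \in cover (val x).
Proof. by rewrite (cover_partition (kpart_partition x)) inE. Qed.

Lemma kpart_block x i : pblock (val x) i \in val x.
Proof. exact/pblock_mem/kpart_cover. Qed.

Lemma same_refl x : reflexive (same x).
Proof. by move=> i; rewrite /same mem_pblock kpart_cover. Qed.

Lemma sameE x i j : same x i j = (pblock (val x) i == pblock (val x) j).
Proof.
by rewrite eq_pblock ?kpart_cover // (partition_trivIset (kpart_partition x)).
Qed.

Lemma same_sym x : symmetric (same x).
Proof. by move=> i j; rewrite !sameE eq_sym. Qed.

Lemma same_left x i j h : same x i j -> same x i h = same x j h.
Proof. by rewrite !sameE => /eqP->. Qed.

Lemma same_right x i j h : same x i j -> same x h i = same x h j.
Proof. by move=> ij; rewrite !(same_sym x h); apply: same_left. Qed.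

Lemma card_same x i : #|same x i| = k.
Proof.
by rewrite -(kpart_uniform (kpart_block x i)); apply: eq_card => j.
Qed.

Lemma same_memP x i j :
  reflect (exists2 B, B \in val x & (i \in B) && (j \in B)) (same x i j).
Proof.
apply: (iffP idP) => [ij|[B xB /andP[iB jB]]].
  by exists (pblock (val x) i); rewrite ?kpart_block // mem_pblock kpart_cover.
by rewrite /same (def_pblock (partition_trivIset (kpart_partition x)) xB iB).
Qed.

Lemma same_inj x y : same x =2 same y -> x = y.
Proof.
move=> xy; apply: val_inj.
rewrite -(equivalence_partition_pblock (kpart_partition x)).
rewrite -(equivalence_partition_pblock (kpart_partition y)).
apply: eq_imset => i; apply/setP=> j; rewrite !inE; exact: xy.
Qed.

Lemma kpart_card x : #|T| = #|val x| * k.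
Proof.
by rewrite -cardsT; apply: card_uniform_partition (kpart_partition x) => B /kpart_uniform.
Qed.

Lemma kact_subproof s x :
  [set s @: (B : {set T}) | B in val x] \in kparts T k.
Proof.
rewrite inE; apply/andP; split.
  have -> : [set: T] = s @: [set: T].
    by apply/esym/setP=> i; rewrite inE -[i](permKV s) imset_f.
  by rewrite imset_partition ?kpart_partition //; apply: perm_inj.
apply/forall_inP=> _ /imsetP[B xB ->].
by rewrite card_imset ?(kpart_uniform xB) //; apply: perm_inj.
Qed.

Definition kact s x : X := Sub (_ : {set {set T}}) (kact_subproof s x).

Lemma same_kact s x i j : same (kact s x) (s i) (s j) = same x i j.
Proof.
apply/same_memP/same_memP => [[_ /imsetP[B xB ->]]|[B xB /andP[iB jB]]].
  by rewrite !(mem_imset _ _ perm_inj); exists B.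
by exists (s @: B); rewrite ?imset_f.
Qed.

Lemma same_kactV s x i j : same (kact s x) i j = same x (s^-1%g i) (s^-1%g j).
Proof. by rewrite -{1}[i](permKV s) -{1}[j](permKV s) same_kact. Qed.

Lemma kactM s t x : kact t (kact s x) = kact (s * t) x.
Proof. by apply: same_inj => i j; rewrite !same_kactV invMg !permM. Qed.

Lemma kact1 x : kact 1 x = x.
Proof. by apply: same_inj => i j; rewrite same_kactV invg1 !perm1. Qed.

Lemma kactK s : cancel (kact s) (kact s^-1).
Proof. by move=> x; rewrite kactM mulgV kact1. Qed.

Lemma kactKV s : cancel (kact s^-1) (kact s).
Proof. by move=> x; rewrite kactM mulVg kact1. Qed.

Lemma same_tperm i j x u v :
  same (kact (tperm i j) x) u v = same x (tperm i j u) (tperm i j v).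
Proof. by rewrite same_kactV tpermV. Qed.

Lemma kact_tpermK i j : involutive (kact (tperm i j)).
Proof. by move=> x; rewrite kactM tperm2 kact1. Qed.

Lemma kact_tperm_id i j x : same x i j -> kact (tperm i j) x = x.
Proof.
move=> ij; apply: same_inj => u v; rewrite same_tperm.
have E w : same x w (tperm i j w).
  by case: tpermP => [->|->|]; rewrite // ?same_refl // same_sym.
by rewrite (same_left _ (E u)) (same_right _ (E v)).
Qed.

(** A partial isomorphism from [x] to [y] extends to one more point [p]. If [p] shares a block with
    some [i] in [D], fewer than [k] points of the block of [s i] are used, so one is free. Otherwise
    [D] misses the block of [p]; as [x] and [y] have equally many blocks, [s @: D] misses a block of
    [y]. *)
Lemma kact_extend_step (x y : X) (s : {perm T}) (D : {set T}) p :
  {in D &, forall i j, same y (s i) (s j) = same x i j} -> p \notin D ->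
  exists2 q, q \notin s @: D & {in D, forall i, same y (s i) q = same x i p}.
Proof.
move=> sD Dp; have [/exists_inP[i Di xip]|] := boolP [exists i in D, same x i p].
  pose A := [set j in D | same x i j].
  have sA : s @: A \subset pblock (val y) (s i).
    by apply/subsetP=> _ /imsetP[j /setIdP[Dj ij] ->]; rewrite -[_ \in _]/(same _ _ _) sD.
  have ltA : #|s @: A| < k.
    rewrite card_imset; last exact: perm_inj.
    rewrite -(card_same x i); apply: proper_card; apply/properP; split.
      by apply/subsetP=> j /setIdP[].
    by exists p; rewrite // inE (negPf Dp).
  have /subsetPn[q yq sq] : ~~ (pblock (val y) (s i) \subset s @: A).
    apply: contraL ltA => /subset_leq_card; rewrite -leqNgt.
    by rewrite (kpart_uniform (kpart_block y _)).
  exists q.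
    apply: contra sq => /imsetP[j Dj qE]; rewrite qE imset_f // inE Dj.
    by rewrite -sD // -qE.
  move=> j Dj; rewrite -(same_right _ yq) -(same_right _ xip) sD //.
rewrite negb_exists_in => /forall_inP xDp.
pose f := pblock (val x); pose g i := pblock (val y) (s i).
have fg : {in D &, forall i j, (f i == f j) = (g i == g j)}.
  by move=> i j Di Dj; rewrite -!sameE sD.
have kgt0 : 0 < k by rewrite -(card_same x p); apply/card_gt0P; exists p; apply: same_refl.
have lt_g : #|g @: D| < #|val y|.
  have -> : #|val y| = #|val x|.
    by apply/eqP; rewrite -(eqn_pmul2r kgt0) -!kpart_card.
  apply: (@leq_ltn_trans #|f @: D|).
    by apply: leq_card_imset_ker => i j Di Dj /eqP; rewrite fg // => /eqP.
  apply: proper_card; apply/properP; split.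
    by apply/subsetP=> _ /imsetP[i _ ->]; apply: kpart_block.
  exists (f p); first exact: kpart_block.
  by apply/imsetP=> -[i /xDp/negP xip /eqP]; rewrite eq_sym -sameE.
have /subsetPn[B yB gB] : ~~ (val y \subset g @: D).
  by apply: contraL lt_g => /subset_leq_card; rewrite -leqNgt.
have /card_gt0P[q Bq] : 0 < #|B| by rewrite (kpart_uniform yB).
have yq : pblock (val y) q = B.
  exact: def_pblock (partition_trivIset (kpart_partition y)) yB Bq.
have qD i : i \in D -> ~~ same y (s i) q.
  by move=> Di; rewrite sameE yq; apply: contraNneq gB => <-; apply: imset_f.
exists q; last by move=> i Di; rewrite (negPf (qD i Di)) (negPf (xDp i Di)).
by apply/imsetP=> -[i Di qE]; have := qD i Di; rewrite -qE same_refl.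
Qed.

(** Homogeneity: iterating the one-point extension makes every partial isomorphism global.
    Transitivity, the independence of counts from the chosen pair, and the dependence of functions
    on a pattern only all come from this. *)
Lemma kact_extend x y s (D : {set T}) :
  {in D &, forall i j, same y (s i) (s j) = same x i j} ->
  exists2 t : {perm T}, {in D, t =1 s} & kact t x = y.
Proof.
have [n] := ubnP #|~: D|; elim: n D s => // n IHn D s /ltnSE le_n sD.
have [D0|[p]] := set_0Vmem (~: D).
  exists s => //; apply: same_inj => i j; rewrite same_kactV.
  have inD h : h \in D by have := in_set0 h; rewrite -D0 inE => /negbT; rewrite negbK.
  by rewrite -sD ?permKV.
rewrite inE => Dp; have [q sDq xyq] := kact_extend_step sD Dp.
(* Both [s p] and [q] lie outside [s @: D], so the correction changes nothing on [D]. *)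
pose s' := (s * tperm (s p) q)%g.
have s'D : {in D, s' =1 s}.
  move=> i Di; rewrite permM tpermD //.
    by rewrite (inj_eq perm_inj); apply: contraNneq Dp => ->.
  by apply: contraNneq sDq => ->; apply: imset_f.
have s'p : s' p = q by rewrite permM tpermL.
have [||t tD tx] := IHn (p |: D) s'.
- apply: leq_trans le_n; apply: proper_card; apply/properP; split.
    by apply/subsetP=> i; rewrite !inE negb_or => /andP[].
  by exists p; rewrite !inE ?eqxx.
- move=> i j /setU1P[->|Di] /setU1P[->|Dj]; rewrite ?s'p ?s'D //.
  + by rewrite !same_refl.
  + by rewrite same_sym xyq // same_sym.
  + exact: xyq.
  + exact: sD.
by exists t => // i Di; rewrite tD ?inE ?Di ?orbT // s'D.
Qed.

Lemma kact_trans x y : exists s, kact s x = y.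
Proof. by have [|t _ <-] := @kact_extend x y 1 set0; [move=> i j; rewrite inE|exists t]. Qed.

Definition orth x y : bool :=
  [forall i, forall j, (i != j) ==> ~~ (same x i j && same y i j)].

Lemma orthP x y :
  reflect (forall i j, i != j -> same x i j -> ~~ same y i j) (orth x y).
Proof.
apply: (iffP 'forall_'forall_implyP) => xy i j ij; last by apply/andP=> -[/(xy _ _ ij)/negP].
by move=> xij; have := xy i j ij; rewrite xij.
Qed.

Lemma orth_sym : symmetric orth.
Proof.
move=> x y; rewrite /orth; apply: eq_forallb => i; apply: eq_forallb => j.
by rewrite [in RHS]andbC.
Qed.

Lemma orth_kact s x y : orth (kact s x) (kact s y) = orth x y.
Proof.
apply/orthP/orthP => xy i j ij.
  by rewrite -(same_kact s x) -(same_kact s y); apply: xy; rewrite (inj_eq perm_inj).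
by rewrite !same_kactV; apply: xy; rewrite (inj_eq perm_inj).
Qed.

End KPart.

(** * Counting and switching *)

Lemma double_count (I J : finType) (P : pred I) (Q : pred J) (R : I -> J -> bool) :
  \sum_(i | P i) #|[pred j | Q j && R i j]| = \sum_(j | Q j) #|[pred i | P i && R i j]|.
Proof.
transitivity (\sum_(i | P i) \sum_(j | Q j && R i j) 1).
  by apply: eq_bigr => i _; rewrite sum1_card; apply: eq_card.
under eq_bigr do rewrite big_mkcondr.
rewrite exchange_big; apply: eq_bigr => j _.
by rewrite -big_mkcondr sum1_card; apply: eq_card.
Qed.

Section Counting.
Variables (T : finType) (k : nat).
Local Notation X := (kpart T k).
Implicit Types (x z : X) (s t : {perm T}).

Lemma card_kact s (P Q : pred X) : (forall z, Q (kact s z) = P z) -> #|P| = #|Q|.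
Proof.
move=> PQ; rewrite -[LHS]cardsE -[RHS]cardsE.
apply: (@bij_card_set _ _ _ _ (kact s) (kact s^-1)) => [z|z|z _|z _]; rewrite ?inE.
- by rewrite unfold_in => Pz; rewrite unfold_in PQ.
- by rewrite unfold_in => Qz; rewrite unfold_in -PQ kactKV.
- exact: kactK.
- exact: kactKV.
Qed.

Lemma card_orth (x y : X) : #|orth x| = #|orth y|.
Proof.
by have [s <-] := kact_trans x y; apply: (@card_kact s) => z; rewrite orth_kact.
Qed.

Lemma perm_pair (a b a' b' : T) : a != b -> a' != b' ->
  exists s : {perm T}, s a = a' /\ s b = b'.
Proof.
move=> ab ab'; have [||//|s [? ?]] := @perm_map_uniq _ [:: a; b] [:: a'; b'].
- by rewrite /= inE ab.
- by rewrite /= inE ab'.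
- by exists s.
Qed.

Lemma card_same_pair (a b a' b' : T) : a != b -> a' != b' ->
  #|[pred z : X | same z a b]| = #|[pred z : X | same z a' b']|.
Proof.
move=> ab /(perm_pair ab)[s [<- <-]].
by apply: (@card_kact s) => z; rewrite /= same_kact.
Qed.

(** Sending [a, b] to [a', b'] is a partial isomorphism from [x] to [x'], since both pairs are
    separated; its extension carries one set onto the other. *)
Lemma card_orth_same x x' (a b a' b' : T) : a != b -> a' != b' ->
  ~~ same x a b -> ~~ same x' a' b' ->
  #|[pred z | orth x z && same z a b]| = #|[pred z | orth x' z && same z a' b']|.
Proof.
move=> ab /(perm_pair ab)[s [sa sb]] xab xab'.
have [i j|t tE <-] := @kact_extend _ _ x x' s [set a; b].
  rewrite !inE => /pred2P[]-> /pred2P[]->; rewrite ?sa ?sb ?same_refl //.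
    by rewrite (negPf xab) (negPf xab').
  by rewrite !(same_sym _ b) same_sym (negPf xab) (negPf xab').
rewrite -sa -sb -!tE ?inE ?eqxx ?orbT //.
by apply: (@card_kact t) => z; rewrite /= orth_kact same_kact.
Qed.

Lemma card_sameD1 x a : #|[pred b | (b != a) && same x a b]| = k.-1.
Proof.
rewrite -[in RHS](card_same x a) (cardD1x (same_refl x a)) add1n.
by apply: eq_card => b; rewrite !inE andbC.
Qed.

Lemma card_same_star (a b : T) : a != b ->
  #|[pred z : X | same z a b]| * #|T|.-1 = #|{: X}| * k.-1.
Proof.
move=> ab.
have := double_count (predC1 a) (@predT X) (fun c z => same z a c).
rewrite [X in X = _ -> _](eq_bigr (fun=> #|[pred z : X | same z a b]|)); last first.
  by move=> c ca; apply: card_same_pair => //; rewrite eq_sym.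
rewrite [X in _ = X -> _](eq_bigr (fun=> k.-1)); last by move=> z _; rewrite -(card_sameD1 z a); apply: eq_card.
by rewrite !sum_nat_const cardC1 mulnC.
Qed.

(** Double counting of pairs [(c, z)] with [z] adjacent to [x] and joining [a] to [c]: all [k.-1]
    companions of [a] in [z] lie among the [#|T| - k] points outside the block of [a] in [x]. *)
Lemma card_orth_star x (a b : T) : ~~ same x a b ->
  #|[pred z | orth x z && same z a b]| * (#|T| - k) = #|orth x| * k.-1.
Proof.
move=> xab; have ab : a != b by apply: contraNneq xab => ->; apply: same_refl.
have := double_count [pred c | ~~ same x a c] (orth x) (fun c z => same z a c).
rewrite [X in X = _ -> _](eq_bigr (fun=> #|[pred z | orth x z && same z a b]|)); last first.
  move=> c /= xac; apply: card_orth_same => //.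
  by apply: contraNneq xac => ->; apply: same_refl.
rewrite [X in _ = X -> _](eq_bigr (fun=> k.-1)); last first.
  move=> z xz; rewrite -(card_sameD1 z a); apply: eq_card => c.
  rewrite !inE /=; case: eqVneq => [->|ca] /=; first by rewrite same_refl.
  by apply: andb_idl => zac; apply: contraL zac => /(orthP _ _ xz); apply; rewrite eq_sym.
rewrite !sum_nat_const mulnC -(cardC (same x a)) card_same addKn => <-.
by congr (_ * _); apply: eq_card.
Qed.

(** Pairs are ordered, so this is twice the number of two-point sets lying in a block of each
    partition. *)
Definition common x z := #|[pred p : T * T | [&& p.1 != p.2, same x p.1 p.2 & same z p.1 p.2]]|.

Lemma common_eq0 x z : (common x z == 0) = orth x z.
Proof.
apply/pred0P/orthP => [H i j ij xij|H [i j]].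
  by have /= := H (i, j); rewrite ij xij /= => ->.
by apply/and3P=> -[/= ij xij]; apply/negP/H.
Qed.

Lemma sum_common x : (\sum_z common x z) * #|T|.-1 = #|T| * k.-1 * (#|{: X}| * k.-1).
Proof.
pose Q := [pred p : T * T | (p.1 != p.2) && same x p.1 p.2].
have -> : \sum_z common x z = \sum_(p | Q p) #|[pred z : X | same z p.1 p.2]|.
  rewrite -(double_count (@predT X) Q (fun z p => same z p.1 p.2)).
  by apply: eq_bigr => z _; apply: eq_card => p; rewrite !inE /= andbA.
rewrite big_distrl /= (eq_bigr (fun=> #|{: X}| * k.-1)); last first.
  by move=> p /andP[ab _]; rewrite -(card_same_star ab).
rewrite sum_nat_const; congr (_ * _).
have := double_count (@predT T) (@predT (T * T)) (fun i p => (p.1 == i) && Q p).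
rewrite [X in X = _ -> _](eq_bigr (fun=> k.-1)); last first.
  move=> i _; rewrite -(card_sameD1 x i).
  rewrite -(card_imset [pred b | (b != i) && same x i b] (f := pair i)); last by move=> ? ? [].
  apply: eq_card => -[u v]; rewrite !inE /=; apply/andP/imsetP => [[/eqP -> uv]|[b + [-> ->]]].
    by exists v; rewrite // inE eq_sym.
  by rewrite inE eq_sym eqxx.
rewrite [X in _ = X -> _](eq_bigr (fun p => (Q p : nat))) => [|p _].
  rewrite sum_nat_const => ->; rewrite -sum1_card [LHS]big_mkcond.
  by apply: eq_bigr => p _; rewrite unfold_in /=; case: (_ && _).
have [Qp|Qp] := boolP (Q p).
  rewrite -[RHS]/1 -[RHS](card1 p.1); apply: eq_card => i; by rewrite !inE /= andbT eq_sym.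
by apply: eq_card0 => i; rewrite !inE  andbF.
Qed.

(** After [u] and [r] trade places in [z], neither of them belongs to a common pair with [x]. Pairs
    avoiding both are unaffected, and [(u, v)] is lost. *)
Lemma common_switch x z u v r : 
  u != v -> same x u v -> same z u v ->
  (forall y : T, same z u y -> ~~ same x r y) -> (forall y : T, same z r y -> ~~ same x u y) ->
  common x (kact (tperm u r) z) < common x z.
Proof.
move=> uv xuv zuv H1 H2.
apply: proper_card; apply/properP; split; last first.
  exists (u, v); rewrite !inE /= ?uv ?xuv ?zuv //= same_tperm tpermL.
  have vr : v != r by apply: contraTneq zuv => ->; apply: contraL (same_refl x r) => /H1.
  rewrite tpermD // 1?eq_sym //.
  by apply: contraL xuv => /H2.
have xru : ~~ same x r u by apply: H1; apply: same_refl.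
have xur : ~~ same x u r by rewrite same_sym.
have key i j : i != j -> same x i j -> same (kact (tperm u r) z) i j ->
    (i != u) && (i != r).
  move=> ij xij; rewrite same_tperm; apply: contraTT.
  rewrite negb_and !negbK => /orP[] /eqP iE; subst i.
    have jr : j != r by apply: contraTneq xij => ->.
    by rewrite tpermL tpermD // 1?eq_sym //; apply: contraL xij => /H2.
  have ju : j != u by apply: contraTneq xij => ->.
  by rewrite tpermR tpermD // 1?eq_sym //; apply: contraL xij => /H1.
apply/subsetP=> -[i j]; rewrite !inE /= => /and3P[ij xij zij].
have /andP[iu ir] := key _ _ ij xij zij.
have /andP[ju jr] : (j != u) && (j != r).
  by apply: (key j i); rewrite 1?eq_sym // same_sym.
move: zij; rewrite same_tperm ij xij.
by rewrite !(@tpermD _ u r) // 1?eq_sym // => ->.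
Qed.

Lemma card_exists_le (U V : finType) (P : pred U) (R : U -> pred V) m c :
  #|P| <= m -> (forall u, P u -> #|R u| <= c) ->
  #|[pred v | [exists u, P u && R u v]]| <= m * c.
Proof.
move=> Pm Rc; apply: (@leq_trans (\sum_(u | P u) #|R u|)).
  have -> : #|[pred v | [exists u, P u && R u v]]| = #|\bigcup_(u | P u) [set v | R u v]|.
    apply: eq_card => v; rewrite inE; apply/existsP/bigcupP => [[u /andP[Pu Ru]]|[u Pu]].
      by exists u; rewrite ?inE.
    by rewrite inE => Ru; exists u; rewrite Pu.
  elim/big_rec2: _ => [|u A m' Pu IH]; first by rewrite cards0.
  apply: leq_trans (leq_card_setU _ _) _; rewrite cardsE leq_add //.
apply: (@leq_trans (\sum_(u | P u) c)); first exact: leq_sum.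
by rewrite sum_nat_const leq_mul2r -[#|_|]/(#|P|) Pm orbT.
Qed.

(** A bad [r] is reached from [u] by a step inside a block of [z] and one inside a block of [x], in
    one of the two orders: at most [k ^ 2] points for each order. *)
Lemma card_switchable x z u : 2 * k ^ 2 <= #|T| -> #|T| - 2 * k ^ 2 <=
  #|[pred r | [forall y, same z u y ==> ~~ same x r y] && [forall y, same z r y ==> ~~ same x u y]]|.
Proof.
move=> kT; set A := [pred r | _]; rewrite leq_subLR -(cardC A) [X in _ <= X]addnC leq_add2l.
apply: (@leq_trans (#|[pred r | [exists y, same z u y && same x y r]]| +
                    #|[pred r | [exists y, same x u y && same z y r]]|)).
  rewrite -cardUI; apply: leq_trans (leq_addr _ _); apply: subset_leq_card.
  apply/subsetP=> r; rewrite !inE negb_and !negb_forall.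
  move=> /orP[] /existsP[y]; rewrite negb_imply negbK => /andP[H1 H2]; apply/orP.
    by left; apply/existsP; exists y; rewrite H1 same_sym.
  by right; apply/existsP; exists y; rewrite H2 same_sym.
rewrite mul2n -addnn leq_add // card_exists_le ?card_same // => y _;
  by rewrite card_same.
Qed.

(** Switchings [(z, (u, r))] are counted from both ends. Each [z] with a common pair admits at least
    [#|T| - 2 * k ^ 2], which is at least half of [#|T|]. Each result arises at most [#|T| * k ^ 2]
    times, as [r] leaves at most [k ^ 2] choices of [u]. *)
Lemma card_common_step x m : 4 * k ^ 2 <= #|T| -> 0 < k ->
  #|[pred z | common x z <= m.+1]| <= (1 + 2 * k ^ 2) * #|[pred z | common x z <= m]|.
Proof.
move=> kT k0; set L := #|[pred z | common x z <= m]|.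
pose bad z u := [exists v, [&& u != v, same x u v & same z u v]].
pose ok z u r := [forall y, same z u y ==> ~~ same x r y] && [forall y, same z r y ==> ~~ same x u y].
pose Om := [set w : X * (T * T) | [&& 0 < common x w.1 <= m.+1, bad w.1 w.2.1 & ok w.1 w.2.1 w.2.2]].
pose Om' := [set w : X * (T * T) | (common x w.1 <= m) && [exists y, same w.1 w.2.2 y && same x y w.2.1]].
have OmOm' : #|Om| <= #|Om'|.
  pose f (w : X * (T * T)) := (kact (tperm w.2.1 w.2.2) w.1, w.2).
  have f_inj : injective f.
    move=> [z p] [z' p'] E; have /= pp' := congr1 snd E.
    by have /= := congr1 fst E; rewrite pp' => /(can_inj (kact_tpermK _ _)) ->.
  rewrite -(card_imset _ f_inj); apply/subset_leq_card/subsetP=> _ /imsetP[[z [u r]] + ->].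
  rewrite !inE /= => /and3P[/andP[_ zm] /existsP[v /and3P[uv xuv zuv]] /andP[/forallP ok1 /forallP ok2]].
  have {}ok1 y : same z u y -> ~~ same x r y by apply/implyP.
  have {}ok2 y : same z r y -> ~~ same x u y by apply/implyP.
  apply/andP; split.
    by rewrite -ltnS; apply: leq_trans zm; apply: (@common_switch _ _ _ v).
  (* In the switched partition [r] has taken the place of [u] beside [v], and [x] joins [v] to [u];
     this is the trace that bounds the number of preimages. *)
  apply/existsP; exists v; rewrite same_tperm tpermR (same_sym x) xuv andbT.
  rewrite tpermD //; apply: contraTneq xuv => <-; rewrite same_sym.
  by apply: ok1; apply: same_refl.
have cOm' : #|Om'| <= L * (#|T| * (k * k)).
  rewrite -[X in X * _]cardsE.
  have -> : #|Om'| = \sum_(z | common x z <= m)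
       #|[pred p : T * T | [exists y, same z p.2 y && same x y p.1]]|.
    rewrite -sum1_card (eq_bigl (fun w : X * (T * T) => (common x w.1 <= m) && [exists y, same w.1 w.2.2 y && same x y w.2.1])).
      rewrite -(pair_big_dep (fun z => common x z <= m) (fun z p => [exists y, same z p.2 y && same x y p.1]) (fun _ _ => 1)) /=.
      by apply: eq_bigr => z _; rewrite sum1_card; apply: eq_card.
    by move=> w; rewrite inE.
  apply: (@leq_trans (\sum_(z | common x z <= m) #|T| * (k * k))); last first.
    by rewrite sum_nat_const -cardsE.
  apply: leq_sum => z _.
  apply: (@leq_trans #|[pred p : T * T | [exists r, predT r && [pred p | (p.2 == r) && [exists y, same z r y && same x y p.1]] p]]|).
    apply/subset_leq_card/subsetP=> -[u r]; rewrite !inE /= => H.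
    by apply/existsP; exists r; rewrite eqxx.
  apply: card_exists_le => // r _.
  apply: (@leq_trans #|[pred u | [exists y, same z r y && same x y u]]|).
    rewrite -[leqRHS](card_imset _ (f := fun u => (u, r))); last by move=> ? ? [].
    apply/subset_leq_card/subsetP=> -[u r']; rewrite !inE /= => /andP[/eqP -> H].
    by apply/imsetP; exists u.
  by apply: card_exists_le; rewrite ?card_same // => y _; rewrite card_same.
have cOm : #|[pred z | 0 < common x z <= m.+1]| * (#|T| - 2 * k ^ 2) <= #|Om|.
  have -> : #|Om| = \sum_(z | 0 < common x z <= m.+1)
       #|[pred p : T * T | bad z p.1 && ok z p.1 p.2]|.
    rewrite -sum1_card (eq_bigl (fun w : X * (T * T) => (0 < common x w.1 <= m.+1) && (bad w.1 w.2.1 && ok w.1 w.2.1 w.2.2))).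
      rewrite -(pair_big_dep (fun z => 0 < common x z <= m.+1) (fun z p => bad z p.1 && ok z p.1 p.2) (fun _ _ => 1)) /=.
      by apply: eq_bigr => z _; rewrite sum1_card; apply: eq_card.
    by move=> w; rewrite inE.
  rewrite -sum_nat_const; apply: leq_sum => z /andP[/card_gt0P[[u v]]].
  rewrite inE /= => uv _.
  have bu : bad z u by apply/existsP; exists v.
  apply: leq_trans (card_switchable x z u _) _; first by lia.
  rewrite -(card_imset _ (f := pair u)); last by move=> ? ? [].
  apply/subset_leq_card/subsetP=> _ /imsetP[r + ->].
  by rewrite !inE /= bu.
have split : #|[pred z | common x z <= m.+1]| <= #|[pred z | 0 < common x z <= m.+1]| + L.
  rewrite -cardUI; apply: leq_trans (leq_addr _ _).
  apply/subset_leq_card/subsetP=> z; rewrite !inE => ->.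
  by case: (common x z).
have : #|[pred z | 0 < common x z <= m.+1]| * (#|T| - 2 * k ^ 2) <= L * (#|T| * (k * k)).
  exact: leq_trans cOm (leq_trans OmOm' cOm').
have T0 : 0 < #|T| by nia.
set N := #|[pred z | 0 < _ <= _]| in split *; move=> H.
have : N <= 2 * k ^ 2 * L.
  rewrite -(@leq_pmul2r #|T|) //.
  apply: (@leq_trans (2 * (N * (#|T| - 2 * k ^ 2)))); last by nia.
  have : #|T| <= 2 * (#|T| - 2 * k ^ 2) by lia.
  by nia.
lia.
Qed.

(** By Markov's inequality at least half of all partitions have at most [4 * k ^ 2] common pairs
    with [x]; that many switching steps bring the bound down to no common pair. *)
Lemma card_orth_lower x : 4 * k ^ 2 <= #|T| -> 0 < k ->
  #|{: X}| <= 2 * (1 + 2 * k ^ 2) ^ (4 * k ^ 2) * #|orth x|.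
Proof.
move=> kT k0; set M := 4 * k ^ 2.
have step m : #|[pred z | common x z <= m]| <= (1 + 2 * k ^ 2) ^ m * #|orth x|.
  elim: m => [|m IHm].
    rewrite mul1n; apply/subset_leq_card/subsetP=> z; rewrite !inE leqn0 common_eq0 //.
  apply: leq_trans (card_common_step x m kT k0) _.
  by rewrite (expnS _ m) -mulnA leq_mul2l IHm orbT.
suff markov : #|{: X}| <= 2 * #|[pred z | common x z <= M]|.
  by apply: leq_trans markov _; rewrite -mulnA leq_mul2l step orbT.
have split : #|{: X}| = #|[pred z | common x z <= M]| + #|[pred z | M < common x z]|.
  rewrite -(cardC [pred z | common x z <= M]); congr (_ + _).
  by apply: eq_card => z; rewrite !inE -ltnNge.
have sumM : #|[pred z | M < common x z]| * M <= \sum_z common x z.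
  rewrite -sum_nat_const [leqRHS](bigID [pred z | M < common x z]) /=.
  by apply: leq_trans (leq_addr _ _); apply: leq_sum => z /ltnW.
(* Here [c] is [k.-1]. From [n <= 2 * n.-1] the total [S] is at most [2 * c ^ 2 * N], so the
   exceptional count [B] is at most half of [N]. *)
have arith n N S A B c : 4 * c.+1 ^ 2 <= n -> S * n.-1 = n * c * (N * c) ->
    B * (4 * c.+1 ^ 2) <= S -> N = A + B -> N <= 2 * A.
  move=> cn H1 H2 H3.
  have n2 : n <= 2 * n.-1 by lia.
  have S2 : S <= 2 * c * c * N.
    rewrite -(@leq_pmul2r n.-1) ?H1; last by lia.
    by have := leq_mul (leqnn (c * (N * c))) n2; nia.
  by have := leq_trans H2 S2; nia.
apply: (arith #|T| _ _ _ _ k.-1 _ (sum_common x)) split; by rewrite prednK.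
Qed.

End Counting.

(** * Spectral bounds for a symmetric relation *)

Section Spectral.
Import Order.TTheory GRing.Theory Num.Theory.
Local Open Scope ring_scope.
Local Open Scope sesquilinear_scope.
Variables (X : finType) (a : rel X).
Hypothesis a_sym : symmetric a.

Definition eigfun (c : algC) (g : {ffun X -> algC}) :=
  forall x, \sum_(y | a x y) g y = c * g x.

(** The spectral theorem for the adjacency matrix, with the eigenbasis indexed by the vertices
    themselves. The last two clauses are orthonormality and completeness, the two sides of
    unitarity. *)
Lemma spectral_basis : exists (D : X -> algC) (P : X -> {ffun X -> algC}),
  [/\ forall i, D i \is Num.real,
      forall i, eigfun (D i) (P i),
      forall i j, \sum_x P i x * (P j x)^* = (i == j)%:R &
      forall x y, \sum_i (P i x)^* * P i y = (x == y)%:R].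
Proof.
pose A : 'M[algC]_#|X| := \matrix_(i, j) (a (enum_val i) (enum_val j))%:R.
have Aherm : A \is hermsymmx.
  apply: realsym_hermsym; last by apply/mxOverP => i j; rewrite mxE realn.
  apply/is_hermitianmxP; rewrite expr0 scale1r map_mx_id //.
  by apply/matrixP=> i j; rewrite !mxE a_sym.
have /orthomx_spectralP AE := hermitian_normalmx Aherm.
have Pu := spectral_unitarymx A; set P := spectralmx A in AE Pu.
set D := spectral_diag A in AE.
have PA : P *m A = diag_mx D *m P.
  by rewrite AE !mulmxA mulmxV ?mul1mx // spectral_unit.
have PP : P *m P^t* = 1%:M by apply/unitarymxP.
have PP' := mulmx1C PP.
have sumE (F : X -> algC) : \sum_x F x = \sum_(i < #|X|) F (enum_val i).
  by rewrite (reindex_onto enum_val enum_rank) => [|x _]; rewrite ?enum_rankK //;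
     apply: eq_bigl => i; rewrite enum_valK eqxx.
exists (fun x => D 0 (enum_rank x)), (fun i => [ffun x => P (enum_rank i) (enum_rank x)]).
split.
- by move=> i; have /mxOverP -> := hermitian_spectral_diag_real Aherm.
- move=> i x; have /matrixP/(_ (enum_rank i) (enum_rank x)) := PA.
  rewrite mul_diag_mx !mxE !ffunE => <-.
  rewrite big_mkcond sumE; apply: eq_bigr => j _.
  rewrite mxE enum_rankK ffunE enum_valK a_sym.
  by case: (a _ _); rewrite ?mulr1 ?mulr0.
- move=> i j; have /matrixP/(_ (enum_rank i) (enum_rank j)) := PP.
  rewrite !mxE (inj_eq enum_rank_inj) => <-; rewrite sumE; apply: eq_bigr => h _.
  by rewrite !ffunE !mxE enum_valK.
- move=> x y; have /matrixP/(_ (enum_rank x) (enum_rank y)) := PP'.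
  rewrite !mxE (inj_eq enum_rank_inj) => <-; rewrite sumE; apply: eq_bigr => h _.
  by rewrite !ffunE !mxE enum_valK.
Qed.

Lemma eigfun_expand (D : X -> algC) (P : X -> {ffun X -> algC}) (h : {ffun X -> algC}) :
  (forall x y, \sum_i (P i x)^* * P i y = (x == y)%:R) ->
  forall y, h y = \sum_i (\sum_x h x * (P i x)^*) * P i y.
Proof.
move=> PP y; under eq_bigr do rewrite big_distrl /=.
rewrite exchange_big /= (bigD1 y) //= [X in _ + X]big1 => [|x xy].
  under eq_bigr do rewrite -mulrA.
  by rewrite -big_distrr /= PP eqxx mulr1 addr0.
under eq_bigr do rewrite -mulrA.
by rewrite -big_distrr /= PP (negPf xy) mulr0.
Qed.

(** In eigenbasis coordinates [c i] the two sides are sums of [c i * (c i)^*] with weights [- e] and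
    [D i]. *)
Lemma quadratic_lower (e : algC) (h : {ffun X -> algC}) :
  (forall c g, eigfun c g -> g != 0 -> c \is Num.real -> - e <= c) ->
  - e * (\sum_x h x * (h x)^*) <= \sum_x (h x)^* * (\sum_(y | a x y) h y).
Proof.
move=> least; have [D [P [Dr eP PPx PPi]]] := spectral_basis.
pose c i := \sum_x h x * (P i x)^*.
have hE := eigfun_expand D h PPi.
have cE i : \sum_x (h x)^* * P i x = (c i)^*.
  rewrite /c rmorph_sum; apply: eq_bigr => x _.
  by rewrite rmorphM /= conjCK.
have -> : \sum_x h x * (h x)^* = \sum_i c i * (c i)^*.
  transitivity (\sum_x \sum_i c i * ((h x)^* * P i x)).
    apply: eq_bigr => x _; rewrite {1}hE big_distrl; apply: eq_bigr => i _ /=.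
    by rewrite -mulrA [P i x * _]mulrC.
  by rewrite exchange_big; apply: eq_bigr => i _; rewrite -big_distrr /= cE.
have -> : \sum_x (h x)^* * (\sum_(y | a x y) h y) = \sum_i D i * (c i * (c i)^*).
  transitivity (\sum_x \sum_i D i * c i * ((h x)^* * P i x)).
    apply: eq_bigr => x _; rewrite (eq_bigr _ (fun y _ => hE y)) exchange_big big_distrr.
    apply: eq_bigr => i _ /=; rewrite -big_distrr /= eP -/(c i); ring.
  rewrite exchange_big; apply: eq_bigr => i _; rewrite -big_distrr /= cE; ring.
rewrite big_distrr /=; apply: ler_sum => i _; apply: ler_wpM2r.
  exact: mul_conjC_ge0.
apply: least (eP i) _ _ => //; apply/eqP=> P0.
have := PPx i i; rewrite eqxx P0 big1 => [/eqP|x _]; last by rewrite ffunE mul0r.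
by rewrite eq_sym oner_eq0.
Qed.

(** Hoffman's bound: the quadratic form is evaluated at the indicator of [F], scaled by [N] and
    shifted to have sum zero. The norm is [N * f * (N - f)] and the form is [- N * f ^ 2 * d]. *)
Lemma ratio_bound (d e : nat) (F : {set X}) :
  (forall x, #|a x| = d) ->
  (forall c g, eigfun c g -> g != 0 -> c \is Num.real -> - e%:R <= c) ->
  {in F &, forall x y, ~~ a x y} ->
  (#|F| * (d + e) <= e * #|X|)%N.
Proof.
move=> ad least coF.
have [->|F0] := eqVneq #|F| 0%N; first by rewrite mul0n.
set f := #|F| in F0 *; set N := #|X|.
have fN : (f <= N)%N by apply: max_card.
pose h : {ffun X -> algC} := [ffun x => N%:R * (x \in F)%:R - f%:R].
have hr x : (h x)^* = h x.
  by apply/CrealP; rewrite ffunE rpredB ?rpredM ?realn.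
have sF : \sum_(x : X) (x \in F)%:R = f%:R :> algC.
  by rewrite -natr_sum -big_mkcond sum1_card.
have sX c : \sum_(x : X) c = N%:R * c :> algC by rewrite sumr_const mulr_natl.
have sA x : \sum_(y | a x y) h y = N%:R * (\sum_(y | a x y) (y \in F)%:R) - f%:R * d%:R.
  rewrite (eq_bigr _ (fun y _ => ffunE _ y)) sumrB -mulr_sumr; congr (_ - _).
  by rewrite sumr_const ad mulr_natr.
have s2 : \sum_x (\sum_(y | a x y) (y \in F)%:R) = f%:R * d%:R :> algC.
  rewrite (exchange_big_dep predT) //= (eq_bigr (fun y => (y \in F)%:R * d%:R)) => [|y _].
    by rewrite -mulr_suml sF.
  rewrite sumr_const mulr_natr; congr (_ *+ _); rewrite -(ad y).
  by apply: eq_card => x; rewrite unfold_in /= a_sym.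
have s3 : \sum_x (x \in F)%:R * (\sum_(y | a x y) (y \in F)%:R) = 0 :> algC.
  rewrite big1 // => x _; case: (boolP (x \in F)) => Fx; last by rewrite mul0r.
  rewrite mul1r big1 // => y axy; case: (boolP (y \in F)) => // Fy.
  by have := coF _ _ Fx Fy; rewrite axy.
have := quadratic_lower h least.
have -> : \sum_x h x * (h x)^* = N%:R * (f%:R * (N%:R - f%:R)).
  transitivity (\sum_(x : X) ((N%:R ^+ 2 - N%:R * f%:R *+ 2) * (x \in F)%:R + f%:R ^+ 2) : algC).
    apply: eq_bigr => x _; rewrite hr ffunE; case: (x \in F) => /=; ring.
  rewrite big_split /= -mulr_sumr sF sX; ring.
have -> : \sum_x (h x)^* * (\sum_(y | a x y) h y) = - (N%:R * (f%:R ^+ 2 * d%:R)).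
  transitivity (\sum_x (N%:R ^+ 2 * ((x \in F)%:R * (\sum_(y | a x y) (y \in F)%:R))
       - N%:R * f%:R * d%:R * (x \in F)%:R - f%:R * N%:R * (\sum_(y | a x y) (y \in F)%:R)
        + f%:R ^+ 2 * d%:R) : algC).
    apply: eq_bigr => x _; rewrite hr sA ffunE; ring.
  rewrite !big_split /= !sumrN -!mulr_sumr s3 s2 sF sX; ring.
rewrite mulNr lerN2 => H.
have : (N * (f ^ 2 * d) <= e * (N * (f * (N - f))))%N.
  by rewrite -(ler_nat algC) !natrM natrB ?natrX.
have f0 : (0 < f)%N by rewrite lt0n.
move=> {}H; suff : (f * d <= e * (N - f))%N by nia.
rewrite -(@leq_pmul2l (N * f)); last by rewrite muln_gt0 f0 (leq_trans f0 fN).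
by move: H; congr (_ <= _)%N; ring.
Qed.

(** Functionals independent on the eigenspace of [c] bound its dimension from below by [#|I|], and
    the squares of all eigenvalues add up to the trace of the squared adjacency matrix, which is the
    sum of the degrees. *)
Lemma eigenspace_dim (I : finType) (c : algC) (phi : I -> {ffun X -> algC}) :
  c \is Num.real ->
  (forall w : I -> algC,
     (forall g, eigfun c g -> \sum_i w i * (\sum_x phi i x * g x) = 0) -> forall i, w i = 0) ->
  #|I|%:R * c ^+ 2 <= (\sum_x #|a x|)%:R.
Proof.
move=> cr indep; have [D [P [Dr eP PPx PPi]]] := spectral_basis.
pose J := [set j | D j == c].
have leIJ : (#|I| <= #|J|)%N.
  pose M : 'M[algC]_(#|I|, #|J|) :=
    \matrix_(i, j) \sum_x phi (enum_val i) x * P (enum_val j) x.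
  suff /eqP <- : row_free M by apply: rank_leq_col.
  rewrite -kermx_eq0; apply/rowV0P => v /sub_kermxP vM.
  suff w0 : forall i : I, v 0 (enum_rank i) = 0.
    by apply/rowP=> i; rewrite mxE -[i]enum_valK w0.
  apply: indep => g gE.
  pose b i := \sum_x g x * (P i x)^*.
  (* Eigenfunctions of distinct eigenvalues are orthogonal, so [g] is spanned by the basis vectors
     indexed by [J]. *)
  have b0 j : D j != c -> b j = 0.
    move=> Djc; suff : (D j - c) * b j = 0.
      by move/eqP; rewrite mulf_eq0 subr_eq0 (negPf Djc) => /eqP.
    rewrite mulrBl; apply/eqP; rewrite subr_eq0; apply/eqP; rewrite /b !mulr_sumr.
    transitivity (\sum_y \sum_(x | a y x) g y * (P j x)^*).
      apply: eq_bigr => y _; rewrite -mulr_sumr -rmorph_sum eP rmorphM /=.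
      by rewrite (CrealP (Dr j)) mulrCA.
    rewrite (exchange_big_dep predT) //=; apply: eq_bigr => x _.
    rewrite mulrA -gE mulr_suml; apply: eq_bigl => y; exact: a_sym.
  have gJ y : g y = \sum_(j in J) b j * P j y.
    rewrite (eigfun_expand D g PPi) (bigID (mem J)) /= [X in _ + X]big1 ?addr0 //.
    by move=> j; rewrite inE => /b0; rewrite /b => ->; rewrite mul0r.
  have vJ j : j \in J -> \sum_i v 0 (enum_rank i) * (\sum_x phi i x * P j x) = 0.
    move=> Jj; have /matrixP/(_ 0 (enum_rank_in Jj j)) := vM; rewrite !mxE => vj0; rewrite -[RHS]vj0.
    rewrite [RHS](reindex_onto enum_rank enum_val) => [|i _]; last by rewrite enum_valK.
    apply: eq_big => [i|i _]; first by rewrite enum_rankK eqxx.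
    by rewrite mxE enum_rankK enum_rankK_in.
  transitivity (\sum_(j in J) b j * (\sum_i v 0 (enum_rank i) * (\sum_x phi i x * P j x))).
    under eq_bigr do under eq_bigr do rewrite gJ mulr_sumr.
    under eq_bigr do rewrite exchange_big /= mulr_sumr.
    rewrite exchange_big /=; apply: eq_bigr => j _; rewrite mulr_sumr; apply: eq_bigr => i _.
    rewrite !mulr_sumr; apply: eq_bigr => x _; ring.
  by rewrite big1 // => j Jj; rewrite vJ // mulr0.
have sumD : \sum_j D j ^+ 2 = (\sum_x #|a x|)%:R.
  transitivity (\sum_j \sum_x (\sum_(y | a x y) P j y) * (\sum_(y | a x y) P j y)^*).
    apply: eq_bigr => j _; transitivity (D j ^+ 2 * (\sum_x P j x * (P j x)^*)).
      by rewrite PPx eqxx mulr1.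
    rewrite mulr_sumr; apply: eq_bigr => x _; rewrite eP rmorphM /= (CrealP (Dr j)); ring.
  rewrite exchange_big natr_sum; apply: eq_bigr => x _ /=.
  transitivity (\sum_(y | a x y) \sum_(z | a x z) (\sum_j (P j z)^* * P j y)).
    under eq_bigr do rewrite rmorph_sum mulr_suml.
    rewrite exchange_big; apply: eq_bigr => y _.
    under eq_bigr do rewrite mulr_sumr.
    by rewrite exchange_big; apply: eq_bigr => z _; apply: eq_bigr => j _; rewrite mulrC.
  rewrite -sum1_card natr_sum; apply: eq_bigr => y xy.
  rewrite (bigD1 y) //= PPi eqxx big1 ?addr0 // => z /andP[_ zy].
  by rewrite PPi (negPf zy).
rewrite -sumD (bigID (mem J)) /= -[leLHS]addr0 lerD //.
  rewrite (eq_bigr (fun=> c ^+ 2)) => [|j]; last by rewrite inE => /eqP ->.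
  rewrite sumr_const -[leRHS]mulr_natl ler_wpM2r ?ler_nat //.
  by rewrite real_exprn_even_ge0.
by apply: sumr_ge0 => j _; rewrite real_exprn_even_ge0.
Qed.

End Spectral.

(** * Eigenfunctions killed by triples of transpositions *)

Section Eigenvalues.
Import Order.TTheory GRing.Theory Num.Theory.
Local Open Scope ring_scope.
Variables (T : finType) (k : nat).
Local Notation X := (kpart T k).
Local Notation fn := {ffun X -> algC}.
Local Notation eig := (eigfun (@orth T k)).
Implicit Types (x z : X) (s t : {perm T}) (g h : fn).

Definition translate s g : fn := [ffun x => g (kact s x)].
Definition diff (i j : T) g : fn := [ffun x => g x - g (kact (tperm i j) x)].

Lemma eig_translate c s g : eig c g -> eig c (translate s g).
Proof.
move=> cg x; rewrite ffunE -cg (reindex_inj (can_inj (kactKV s))) /=.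
by apply: eq_big => [y|y _]; rewrite ?ffunE ?kactKV // -(orth_kact s) kactKV.
Qed.

Lemma eig_diff c i j g : eig c g -> eig c (diff i j g).
Proof.
move=> cg x; have := eig_translate (tperm i j) cg x; rewrite !ffunE mulrBr -(cg x) => <-.
rewrite -sumrB; apply: eq_bigr => y _; by rewrite !ffunE.
Qed.

Lemma diff_kact i j g x : diff i j g (kact (tperm i j) x) = - diff i j g x.
Proof. by rewrite !ffunE kact_tpermK opprB. Qed.

Lemma diffC (i j u v : T) g : uniq [:: i; j; u; v] ->
  diff i j (diff u v g) = diff u v (diff i j g).
Proof.
rewrite /= !inE !negb_or => /and4P[/and3P[ij iu iv] /andP[ju jv] uv _].
apply/ffunP=> x; rewrite !ffunE !kactM.
suff -> : (tperm i j * tperm u v = tperm u v * tperm i j)%g by ring.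
apply/permP=> w; rewrite !permM.
have [->|wi] := eqVneq w i; first by rewrite tpermL !(@tpermD _ u v) ?tpermL // eq_sym.
have [->|wj] := eqVneq w j; first by rewrite tpermR !(@tpermD _ u v) ?tpermR // eq_sym.
rewrite (@tpermD _ i j w) 1?eq_sym //.
by case: (tpermP u v w) => [_|_|_ _]; rewrite tpermD // eq_sym.
Qed.

(** Partitions with the same pattern on [D] differ by a permutation fixing [D] pointwise, which is a
    product of transpositions outside [D], and each of these preserves [h]. *)
Lemma eq_of_diff (D : {set T}) h :
  (forall u v, u != v -> u \notin D -> v \notin D -> diff u v h = 0) ->
  forall x z, {in D &, forall i j, same x i j = same z i j} -> h x = h z.
Proof.
move=> hD x z xz; have [|t tD <-] := @kact_extend _ _ x z 1 D.
  by move=> i j Di Dj; rewrite !perm1 xz.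
have : perm_on (~: D) t.
  apply/subsetP=> i; rewrite !inE; apply: contraNN => Di.
  by rewrite tD // perm1.
move: t {tD xz} => t /(perm_on_tperm_ind (K := fun t => forall x, h x = h (kact t x))); apply.
  by move=> y; rewrite kact1.
move=> s u v; rewrite !inE => Du Dv hs y; rewrite -kactM hs.
have [->|uv] := eqVneq u v; first by rewrite tperm1 kact1.
by have /ffunP/(_ (kact s y)) := hD _ _ uv Du Dv; rewrite !ffunE => /eqP; rewrite subr_eq0 => /eqP.
Qed.

Lemma exists_unrelated x (s : seq T) : (size s * k < #|T|)%N ->
  exists v, forall u, u \in s -> ~~ same x u v.
Proof.
move=> sk; have : (#|[pred v | [exists u, (u \in s) && same x u v]]| < #|T|)%N.
  apply: leq_ltn_trans sk; apply: card_exists_le; first exact: card_size.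
  by move=> u _; rewrite card_same.
rewrite -[X in (_ < X)%N](cardC [pred v | [exists u, (u \in s) && same x u v]]) -[X in (X < _)%N]addn0 ltn_add2l.
case/card_gt0P => v; rewrite !inE => /existsPn Hv; exists v => u us.
by have := Hv u; rewrite us.
Qed.

Lemma exists_related x (v : T) : (1 < k)%N -> exists2 w, w != v & same x v w.
Proof.
move=> k1; have : (0 < #|[pred b | (b != v) && same x v b]|)%N by rewrite card_sameD1; lia.
by case/card_gt0P => w; rewrite inE => /andP[]; exists w.
Qed.

(** Suitable points are found greedily in [x], then a permutation moves four of them to the
    prescribed places. The points [e], [f], [p] in blocks of their own will serve to detach single
    points by transpositions. *)
Lemma pattern_exists x (a b c d : T) : uniq [:: a; b; c; d] -> (1 < k)%N -> (5 * k <= #|T|)%N ->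
  exists z e f p, [/\ same z a c, same z b d & pairwise (fun i j => ~~ same z i j) [:: a; b; e; f; p]].
Proof.
move=> abcd k1 kT.
have ltk n : (n < 5)%N -> (n * k < #|T|)%N by nia.
have [a' _] : exists v, forall u, u \in [::] -> ~~ same x u v by apply: exists_unrelated; apply: (ltk 0).
have [c' ca ac] := exists_related x a' k1.
have [b' /(_ a' (mem_head _ _)) ab] := exists_unrelated x (ltk 1 isT : (size [:: a'] * k < _)%N).
have [d' db bd] := exists_related x b' k1.
have [e He] := exists_unrelated x (ltk 2 isT : (size [:: a'; b'] * k < _)%N).
have [f Hf] := exists_unrelated x (ltk 3 isT : (size [:: a'; b'; e] * k < _)%N).
have [p Hp] := exists_unrelated x (ltk 4 isT : (size [:: a'; b'; e; f] * k < _)%N).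
have neq (i j : T) : ~~ same x i j -> i != j by apply: contraNneq => ->; apply: same_refl.
have [||//|s [sa sb sc sd]] := @perm_map_uniq _ [:: a'; b'; c'; d'] [:: a; b; c; d].
- rewrite /= !inE !negb_or !(eq_sym _ c') !(eq_sym _ d') ca db /= andbT.
  rewrite !neq //.
  + by rewrite -(same_left _ bd) -(same_right _ ac) same_sym.
  + by rewrite -(same_left _ ac).
  + by rewrite -(same_left _ bd) same_sym.
- exact: abcd.
exists (kact s x), (s e), (s f), (s p); rewrite -sa -sb -sc -sd !same_kact; split=> //.
rewrite /= !same_kact ab !andbT !He ?Hf ?Hp // !inE eqxx ?orbT //.
Qed.

(** * Double differences when all triple differences vanish *)

Section Killed.
Variables (a b c d : T) (h : fn).
Hypotheses (abcd : uniq [:: a; b; c; d]) (k1 : (1 < k)%N) (kT : (5 * k <= #|T|)%N).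
Hypotheses (hab : forall x, h (kact (tperm a b) x) = - h x)
           (hcd : forall x, h (kact (tperm c d) x) = - h x)
           (hoff : forall u v, uniq [:: a; b; c; d; u; v] -> diff u v h = 0)
           (hkill : forall i j u v e f, uniq [:: i; j; u; v; e; f] ->
              diff i j (diff u v (diff e f h)) = 0).

Let pat x z := [&& same x a b == same z a b, same x c d == same z c d,
  same x a c == same z a c, same x a d == same z a d,
  same x b c == same z b c & same x b d == same z b d].

Lemma killed_pattern x z : pat x z -> h x = h z.
Proof.
case/and5P=> /eqP ab /eqP cd /eqP ac /eqP ad /andP[/eqP bc /eqP bd].
apply: (@eq_of_diff [set a; b; c; d]) => [u v uv|i j].
  rewrite !inE !negb_or -!andbA => /and4P[ua ub uc ud] /and4P[va vb vc vd].
  apply: hoff; move: abcd; rewrite /= !inE !negb_or.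
  by rewrite !(eq_sym _ u) !(eq_sym _ v) ua ub uc ud va vb vc vd (eq_sym v) uv => /and4P[/and3P[-> -> ->] /andP[-> ->] -> _].
rewrite !inE -!orbA => /or4P[] /eqP -> /or4P[] /eqP -> //; rewrite ?same_refl //.
all: by rewrite same_sym [RHS]same_sym.
Qed.

Let tabE : [/\ tperm a b a = b, tperm a b b = a, tperm a b c = c & tperm a b d = d].
Proof.
move: abcd; rewrite /= !inE !negb_or => /and4P[/and3P[? ? ?] /andP[? ?] _ _].
by rewrite tpermL tpermR !tpermD.
Qed.

Let tcdE : [/\ tperm c d a = a, tperm c d b = b, tperm c d c = d & tperm c d d = c].
Proof.
move: abcd; rewrite /= !inE !negb_or => /and4P[/and3P[? ? ?] /andP[? ?] _ _].
by rewrite tpermL tpermR !tpermD // eq_sym.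
Qed.

Let opp_eq0 (r : algC) : r = - r -> r = 0.
Proof. by move/eqP; rewrite -addr_eq0 -mulr2n mulrn_eq0 => /eqP. Qed.

(** Exchanging [a] and [b] keeps the pattern but changes the sign of [h]. *)
Lemma killed_ab x : same x a c = same x b c -> same x a d = same x b d -> h x = 0.
Proof.
move=> Hc Hd; apply: opp_eq0; rewrite -hab; apply: killed_pattern.
have [ta tb tc td] := tabE.
by rewrite /pat !same_tperm ta tb tc td Hc Hd same_sym !eqxx.
Qed.

Lemma killed_cd x : same x a c = same x a d -> same x b c = same x b d -> h x = 0.
Proof.
move=> Hc Hd; apply: opp_eq0; rewrite -hcd; apply: killed_pattern.
have [ta tb tc td] := tcdE.
by rewrite /pat !same_tperm ta tb tc td Hc Hd (same_sym _ d) !eqxx.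
Qed.

Definition cross x : algC :=
  (same x a c)%:R - (same x b c)%:R - (same x a d)%:R + (same x b d)%:R.

Definition pattern_ac x := [&& same x a c, ~~ same x a b, ~~ same x c d, ~~ same x a d, ~~ same x b c & ~~ same x b d].
Definition pattern_bd x := [&& same x b d, ~~ same x a b, ~~ same x c d, ~~ same x a d, ~~ same x b c & ~~ same x a c].
Definition pattern_ac_bd x := [&& same x a c, same x b d, ~~ same x a b, ~~ same x c d, ~~ same x a d & ~~ same x b c].

Lemma killed_ac x z : pattern_ac x -> pattern_ac z -> h x = h z.
Proof.
move=> /and5P[x1 /negPf x2 /negPf x3 /negPf x4 /andP[/negPf x5 /negPf x6]].
move=> /and5P[z1 /negPf z2 /negPf z3 /negPf z4 /andP[/negPf z5 /negPf z6]].
by apply: killed_pattern; rewrite /pat x1 x2 x3 x4 x5 x6 z1 z2 z3 z4 z5 z6.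
Qed.

Lemma killed_ac_bd x z : pattern_ac_bd x -> pattern_ac_bd z -> h x = h z.
Proof.
move=> /and5P[x1 x2 /negPf x3 /negPf x4 /andP[/negPf x5 /negPf x6]].
move=> /and5P[z1 z2 /negPf z3 /negPf z4 /andP[/negPf z5 /negPf z6]].
by apply: killed_pattern; rewrite /pat x1 x2 x3 x4 x5 x6 z1 z2 z3 z4 z5 z6.
Qed.

(** The transpositions [(a b)] and [(c d)] together exchange the two patterns, and their signs
    cancel. *)
Lemma killed_bd x z : pattern_bd x -> pattern_ac z -> h x = h z.
Proof.
move=> xp zp; rewrite -[LHS]opprK -hab -hcd; apply: killed_ac zp; move: xp.
have [ta tb tc td] := tabE; have [ta' tb' tc' td'] := tcdE.
rewrite /pattern_ac !same_tperm ta' tb' tc' td' ta tb tc td.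
move=> /and5P[-> x2 x3 x4 /andP[x5 x6]].
by rewrite (same_sym _ b a) (same_sym _ d c) x2 x3 x4 x5 x6.
Qed.

Lemma killed_none x : ~~ same x a c -> ~~ same x b c -> ~~ same x a d -> ~~ same x b d -> h x = 0.
Proof. by move=> /negPf ac /negPf bc /negPf ad /negPf bd; apply: killed_ab; rewrite ?ac ?ad. Qed.

Local Notation t i j := (kact (tperm i j)).

(** Up to sign, the only patterns where [h] may be nonzero are one related pair, of value [y], and
    two related pairs, as at [z]. Vanishing of a triple difference at [z] forces the ratio 2 between
    them, which is the ratio for [cross]. *)
Lemma killed_cross x0 : exists y, forall x, h x = y * cross x.
Proof.
have [z [e [f [p [zac zbd]]]]] := pattern_exists x0 abcd k1 kT.
rewrite /= !andbT => /and4P[/and4P[ab ae af ap] /and3P[be bf bp] /andP[ef ep] fp].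
(* From here to [tE], rewrite rules are collected that compute every pattern of a transposed copy of
   [z]. *)
have zs i j : ~~ same z i j -> (same z i j = false) * (same z j i = false) * ((i == j) = false) * ((j == i) = false).
  move=> ij; rewrite (same_sym _ j) (eq_sym j) (negPf ij).
  by have /negPf-> : i != j by apply: contraNneq ij => ->; apply: same_refl.
have zR := (same_refl z, zs _ _ ab, zs _ _ ae, zs _ _ af, zs _ _ ap, zs _ _ be,
  zs _ _ bf, zs _ _ bp, zs _ _ ef, zs _ _ ep, zs _ _ fp).
have zc i : (same z c i = same z a i) * (same z i c = same z i a).
  by rewrite -(same_left _ zac) -(same_right _ zac).
have zd i : (same z d i = same z b i) * (same z i d = same z i b).
  by rewrite -(same_left _ zbd) -(same_right _ zbd).
have cn i : ~~ same z a i -> ((c == i) = false) * ((i == c) = false).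
  by rewrite (same_left _ zac) => /zs E; rewrite !E.
have dn i : ~~ same z b i -> ((d == i) = false) * ((i == d) = false).
  by rewrite (same_left _ zbd) => /zs E; rewrite !E.
have nE := (cn e ae, cn f af, cn p ap, dn e be, dn f bf, dn p bp).
have [/negPf ac /negPf ad /negPf bc /negPf bd /negPf cd] : [/\ a != c, a != d, b != c, b != d & c != d].
  by move: abcd; rewrite /= !inE !negb_or => /and4P[/and3P[_ -> ->] /andP[-> ->] -> _].
have neqE := (zR, nE, ac, ad, bc, bd, cd, eq_sym c a, eq_sym d a, eq_sym c b, eq_sym d b, eq_sym d c, eqxx).
have tE i j v : tperm i j v = if v == i then j else if v == j then i else v.
  by case: tpermP => [->|->|/eqP/negPf-> /eqP/negPf->]; rewrite ?eqxx //; case: eqP.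
(* Exchanging [b] with [f] separates [b] from [d], so only [a] and [c] stay together. *)
set y := h (t b f z).
have y_ac : pattern_ac (t b f z).
  by rewrite /pattern_ac !same_tperm !tE !neqE /= ?(zc, zd, zR).
(* Of the eight translates in the triple relation at [z], one has value [h z],
   four are of the patterns "only a, c" or "only b, d" and have value [y], with
   signs -, -, -, +, and in the other three the points a, b, c, d are unrelated. *)
have h_z : h z = y *+ 2.
  have /ffunP/(_ z) : diff a e (diff b f (diff c p h)) = 0.
    by apply: hkill; rewrite /= !inE !neqE.
  rewrite !ffunE -/y.
  have -> : h (t c p z) = y.
    by apply: killed_bd y_ac; rewrite /pattern_bd !same_tperm !tE !neqE /= ?(zc, zd, zR).
  have -> : h (t a e z) = y.
    by apply: killed_bd y_ac; rewrite /pattern_bd !same_tperm !tE !neqE /= ?(zc, zd, zR).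
  have -> : h (t c p (t a e z)) = y.
    by apply: killed_bd y_ac; rewrite /pattern_bd !same_tperm !tE !neqE /= ?(zc, zd, zR).
  rewrite !(killed_none (x := t _ _ (t _ _ _)));
    try by rewrite !same_tperm !tE !neqE /= ?(zc, zd, zR).
  move=> H; apply/eqP; rewrite -subr_eq0 -[X in _ == X]H; apply/eqP; ring.
(* If instead [a, d] or [b, c] are together, [(c d)] leads back to this case, as it negates both [h]
   and [cross]. *)
exists y; suff main x : same x a c || same x b d -> h x = y * cross x.
  move=> x; have [/main //|] := boolP (same x a c || same x b d).
  rewrite negb_or => /andP[xac xbd].
  have [xx|] := boolP (same x a d || same x b c); last first.
    rewrite negb_or => /andP[xad xbc]; rewrite killed_none //.
    by rewrite /cross (negPf xac) (negPf xbd) (negPf xad) (negPf xbc) !(subr0, addr0) mulr0.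
  have [ta tb tc td] := tcdE.
  rewrite -[LHS]opprK -hcd main; last by rewrite !same_tperm ta tb tc td.
  rewrite /cross !same_tperm ta tb tc td; ring.
have [xab _|xab] := boolP (same x a b).
  rewrite killed_ab ?(same_left _ xab) // /cross !(same_left _ xab) subrr sub0r addNr mulr0 //.
have [xcd _|xcd] := boolP (same x c d).
  rewrite killed_cd ?(same_right _ xcd) // /cross !(same_right _ xcd); ring.
move=> xx; have xad : ~~ same x a d.
  apply/negP => Had; case/orP: xx => [Hac|Hbd].
    by rewrite (same_left _ Hac) (negPf xcd) in Had.
  by rewrite -(same_right _ Hbd) (negPf xab) in Had.
have xbc : ~~ same x b c.
  apply/negP => Hbc; case/orP: xx => [Hac|Hbd].
    by rewrite -(same_right _ Hac) same_sym (negPf xab) in Hbc.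
  by rewrite (same_left _ Hbd) same_sym (negPf xcd) in Hbc.
have [xac|xac] := boolP (same x a c); have [xbd|xbd] := boolP (same x b d).
- rewrite (@killed_ac_bd x z) ?h_z /cross ?xac ?xbd ?(negPf xad) ?(negPf xbc).
  + by rewrite /=; ring.
  + by rewrite /pattern_ac_bd xac xbd xab xcd xad xbc.
  + by rewrite /pattern_ac_bd ?(zc, zd, zR).
- rewrite (killed_ac _ y_ac); last by rewrite /pattern_ac xac xbd xab xcd xad xbc.
  rewrite /cross xac (negPf xbd) (negPf xad) (negPf xbc) -/y /=; ring.
- rewrite (killed_bd _ y_ac); last by rewrite /pattern_bd xac xbd xab xcd xad xbc.
  rewrite /cross xbd (negPf xac) (negPf xad) (negPf xbc) -/y /=; ring.
by rewrite (negPf xac) (negPf xbd) in xx.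
Qed.
End Killed.


Lemma eig_const c g : eig c g -> g != 0 -> (forall x z, g x = g z) ->
  exists x, c = #|orth x|%:R.
Proof.
move=> cg g0 gconst; have [x gx] : exists x, g x != 0.
  apply/existsP; apply: contraNT g0; rewrite negb_exists => /forallP g0.
  by apply/eqP/ffunP=> x; rewrite ffunE; apply/eqP; have := g0 x; rewrite negbK.
exists x; apply: (mulIf gx); rewrite -cg (eq_bigr _ (fun y _ => gconst y x)).
by rewrite sumr_const mulr_natl.
Qed.

(** The adjacency operator maps the indicator of a pair being together to [e] times its complement.
    The constants cancel in the alternating sum [cross], leaving the factor [- e]. *)
Lemma eig_cross (e : nat) c (a b u v : T) (y : algC) :
  uniq [:: a; b; u; v] ->
  (forall x (i j : T), i != j -> ~~ same x i j -> #|[pred z | orth x z && same z i j]| = e) ->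
  eig c [ffun x => y * cross a b u v x] -> [ffun x => y * cross a b u v x] != 0 :> fn ->
  c = - e%:R.
Proof.
move=> abuv eE cg.
have sumE x (i j : T) : i != j -> \sum_(z | orth x z) (same z i j)%:R = e%:R * (1 - (same x i j)%:R) :> algC.
  move=> ij; rewrite -natr_sum -big_mkcondr sum1_card; case: (boolP (same x i j)) => xij.
    rewrite subrr mulr0 eq_card0 // => z; rewrite unfold_in; apply/negP => /andP[xz].
    exact/negP/(orthP _ _ xz).
  by rewrite subr0 mulr1; congr _%:R; rewrite -(eE x i j) //; apply: eq_card.
move: abuv; rewrite /= !inE !negb_or => /and4P[/and3P[ab au av] /andP[bu bv] uv _].
apply: contraNeq => cE; apply/eqP/ffunP=> x; rewrite !ffunE; apply/eqP.
have : (c + e%:R) * (y * cross a b u v x) = 0.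
  rewrite mulrDl; have := cg x; rewrite ffunE => <-.
  under eq_bigr do rewrite ffunE /cross.
  rewrite -mulr_sumr !big_split /= !sumrN !sumE // /cross; ring.
by move/eqP; rewrite mulf_eq0 addr_eq0 (negPf cE).
Qed.

(** A nonzero double difference is a multiple of [cross]. If all double differences vanish, [g] is
    shown to be constant. *)
Lemma eig_killed (e : nat) c g : (1 < k)%N -> (5 * k <= #|T|)%N ->
  (forall x (i j : T), i != j -> ~~ same x i j -> #|[pred z | orth x z && same z i j]| = e) ->
  eig c g -> g != 0 ->
  (forall g i j u v p q, eig c g -> uniq [:: i; j; u; v; p; q] -> diff i j (diff u v (diff p q g)) = 0) ->
  c = - e%:R \/ exists x, c = #|orth x|%:R.
Proof.
move=> k1 kT eE cg g0 kill.
have [/existsP[a /existsP[b /existsP[u /existsP[v /andP[abuv h0]]]]]|kill2] :=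
  boolP [exists a, exists b, exists u, exists v, uniq [:: a; b; u; v] && (diff a b (diff u v g) != 0)].
  left; set h := diff a b _ in h0.
  have ch : eig c h by do 2!apply: eig_diff.
  have hC : h = diff u v (diff a b g) by apply: diffC.
  have [x0 _] : exists x0, h x0 != 0.
    apply/existsP; apply: contraNT h0; rewrite negb_exists => /forallP h0.
    by apply/eqP/ffunP=> x; rewrite [RHS]ffunE; apply/eqP; have := h0 x; rewrite negbK.
  have [||i j abuvij||y hE] := @killed_cross a b u v h abuv k1 kT _ _ _ _ x0.
  - by move=> x; apply: diff_kact.
  - by move=> x; rewrite hC diff_kact.
  - rewrite -[RHS](kill g i j a b u v) //.
    by rewrite (uniq_catC [:: i; j] [:: a; b; u; v]).
  - by move=> *; apply: kill.
  have hE' : h = [ffun x => y * cross a b u v x] by apply/ffunP=> x; rewrite [RHS]ffunE hE.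
  by apply: (@eig_cross e c a b u v y abuv eE); rewrite -hE'.
right; apply: (eig_const cg g0) => x z; apply: (@eq_of_diff set0) => [a b ab _ _|i j].
  apply/ffunP=> {}x; rewrite [RHS]ffunE; set h := diff a b g.
  (* Now [h] depends only on whether [a] and [b] are together, which [(a b)] does not alter; being
     also antisymmetric under [(a b)], it is zero. *)
  have : h (kact (tperm a b) x) = h x.
    apply: (@eq_of_diff [set a; b]) => [u v uv|i j].
      rewrite !inE !negb_or => /andP[ua ub] /andP[va vb].
      have abuv : uniq [:: a; b; u; v].
        by rewrite /= !inE !negb_or ab uv !(eq_sym a) !(eq_sym b) ua ub va vb.
      rewrite /h -diffC //; apply: contraNeq kill2 => h0.
      by apply/existsP; exists a; apply/existsP; exists b; apply/existsP; exists u; apply/existsP; exists v; rewrite abuv.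
    rewrite same_tperm !inE => /pred2P[]-> /pred2P[]->; rewrite ?tpermL ?tpermR ?same_refl //.
      by rewrite same_sym.
    by rewrite same_sym.
  by rewrite /h diff_kact => /esym/eqP; rewrite -addr_eq0 -mulr2n mulrn_eq0 => /eqP.
by rewrite inE.
Qed.

End Eigenvalues.

(** * Eigenfunctions of weight three *)

Section Pairs.
Variable T : eqType.
Implicit Types (ps qs : seq (T * T)) (p q r : T * T).

(** A pair stands for a transposition; [uniq (unpair ps)] says that these are nontrivial and
    pairwise disjoint. *)
Definition unpair ps : seq T := flatten [seq [:: p.1; p.2] | p <- ps].

Lemma unpair_perm ps qs : perm_eq ps qs -> perm_eq (unpair ps) (unpair qs).
Proof. by move=> pq; apply: perm_flatten; apply: perm_map. Qed.

Lemma unpair_map (U : eqType) (f : T -> U) ps :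
  map f (unpair ps) = flatten [seq [:: f p.1; f p.2] | p <- ps].
Proof. by elim: ps => //= p ps <-. Qed.

Lemma size_unpair ps : size (unpair ps) = 2 * size ps.
Proof. by elim: ps => //= p ps ->; rewrite mulnS. Qed.

Lemma unpair_inj ps qs : unpair ps = unpair qs -> ps = qs.
Proof. by elim: ps qs => [|[a b] ps IH] [|[c d] qs] //= [-> -> /IH ->]. Qed.

Lemma unpair_uniq ps : uniq (unpair ps) -> uniq ps.
Proof.
elim: ps => //= p ps IHps /and3P[]; rewrite inE negb_or => /andP[_ p1] _ /IHps ->.
rewrite andbT; apply: contra p1 => pps.
by apply/flattenP; exists [:: p.1; p.2]; rewrite ?mem_head //; apply/mapP; exists p.
Qed.

Lemma unpair_disjoint ps p q : uniq (unpair ps) -> p \in ps -> q \in ps -> p != q ->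
  uniq [:: p.1; p.2; q.1; q.2].
Proof.
move=> ups pps qps pq; have qr : q \in rem p ps by rewrite rem_filter ?unpair_uniq // mem_filter /= eq_sym pq.
have : perm_eq ps (p :: q :: rem q (rem p ps)).
  by apply: perm_trans (perm_to_rem pps) _; rewrite perm_cons perm_to_rem.
move/unpair_perm/perm_uniq; rewrite ups => /esym.
rewrite -[unpair _]/([:: p.1; p.2; q.1; q.2] ++ unpair (rem q (rem p ps))).
by rewrite cat_uniq => /and3P[].
Qed.

Lemma perm_front3 ps p q r : p \in ps -> q \in ps -> r \in ps -> uniq [:: p; q; r] ->
  exists rest, perm_eq ps [:: p, q, r & rest].
Proof.
have step (x y : T * T) s : x \in s -> x != y -> x \in rem y s.
  move=> xs xy; have [ys|ys] := boolP (y \in s); last by rewrite rem_id.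
  by have := perm_mem (perm_to_rem ys) x; rewrite xs inE (negPf xy) /= => <-.
move=> pps qps rps; rewrite /= !inE !negb_or andbT => /andP[/andP[pq pr] qr].
exists (rem r (rem q (rem p ps))).
apply: perm_trans (perm_to_rem pps) _; rewrite perm_cons.
rewrite eq_sym in pq; rewrite eq_sym in pr; rewrite eq_sym in qr.
apply: perm_trans (perm_to_rem (step _ _ _ qps pq)) _; rewrite perm_cons.
exact: perm_to_rem (step _ _ _ (step _ _ _ rps pr) qr).
Qed.

End Pairs.

Section CaseA.
Import Order.TTheory GRing.Theory Num.Theory.
Local Open Scope ring_scope.
Variables (T : finType) (k : nat).
Local Notation X := (kpart T k).
Local Notation fn := {ffun X -> algC}.
Local Notation eig := (eigfun (@orth T k)).
Implicit Types (x z : X) (s t : {perm T}) (g h : fn) (p q r : T * T) (ps qs : seq (T * T)).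

Definition diffp p : fn -> fn := diff p.1 p.2.
Definition diffs ps g : fn := foldr diffp g ps.

Lemma eig_diffs c ps g : eig c g -> eig c (diffs ps g).
Proof. by move=> cg; elim: ps => //= p ps; apply: eig_diff. Qed.

Lemma diffs_cat ps qs g : diffs (ps ++ qs) g = diffs ps (diffs qs g).
Proof. exact: foldr_cat. Qed.

(** Half of [diffp p] is the projection onto the functions antisymmetric under the transposition. *)
Lemma diffpp p g : diffp p (diffp p g) = diffp p g *+ 2.
Proof.
apply/ffunP=> x; rewrite ffunMnE /diffp !ffunE kact_tpermK; ring.
Qed.

Lemma diffp_same p g x : same x p.1 p.2 -> diffp p g x = 0.
Proof. by move=> xp; rewrite ffunE kact_tperm_id // subrr. Qed.

Section Commuting.
Variable family : seq (T * T).
Hypothesis family_uniq : uniq (unpair family).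

Lemma diffpC p q g : p \in family -> q \in family -> diffp p (diffp q g) = diffp q (diffp p g).
Proof.
move=> pf qf; have [-> //|pq] := eqVneq p q.
exact: diffC (unpair_disjoint family_uniq pf qf pq).
Qed.

Lemma diffs_front p ps g : p \in ps -> {subset ps <= family} ->
  diffs ps g = diffp p (diffs (rem p ps) g).
Proof.
elim: ps => //= q ps IHps; rewrite inE eq_sym => /predU1P[-> _|pps sub]; first by rewrite eqxx.
have [-> //|qp] := eqVneq q p.
rewrite IHps // => [|r rps]; last by apply: sub; rewrite inE rps orbT.
by rewrite diffpC ?sub ?inE ?eqxx ?pps ?orbT.
Qed.

Lemma diffs_double p ps g : p \in ps -> {subset ps <= family} ->
  diffs (p :: ps) g = diffs ps g *+ 2.
Proof. by move=> pps sub /=; rewrite (diffs_front _ pps sub) diffpp. Qed.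

Lemma diffs3_square p q r g : {subset [:: p; q; r] <= family} ->
  diffs [:: p; q; r] (diffs [:: p; q; r] g) = diffs [:: p; q; r] g *+ 8.
Proof.
move=> sub; rewrite -diffs_cat.
have sub' ps : all (mem [:: p; q; r]) ps -> {subset ps <= family}.
  by move/allP => H w /H /sub.
rewrite !cat_cons cat0s.
rewrite (@diffs_double p [:: q; r; p; q; r]); first last.
- by apply: sub'; rewrite /= !inE !eqxx ?orbT.
- by rewrite !inE eqxx ?orbT.
rewrite (@diffs_double q [:: r; p; q; r]); first last.
- by apply: sub'; rewrite /= !inE !eqxx ?orbT.
- by rewrite !inE eqxx ?orbT.
rewrite (@diffs_double r [:: p; q; r]); first last.
- by apply: sub'; rewrite /= !inE !eqxx ?orbT.
- by rewrite !inE eqxx ?orbT.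
by rewrite -!mulrnA.
Qed.

End Commuting.

Lemma diff_adjoint i j g h : \sum_x diff i j g x * h x = \sum_x g x * diff i j h x.
Proof.
under eq_bigr do rewrite ffunE mulrBl; under [RHS]eq_bigr do rewrite ffunE mulrBr.
rewrite !sumrB; congr (_ - _); rewrite (reindex_inj (inv_inj (@kact_tpermK T k i j))) /=.
by apply: eq_bigr => x _; rewrite kact_tpermK.
Qed.

Lemma translate_diff s i j g :
  translate s^-1 (diff i j g) = diff (s i) (s j) (translate s^-1 g).
Proof.
apply/ffunP=> x; rewrite !ffunE !kactM; congr (_ - g (kact _ x)).
by rewrite -tpermJ /conjg !mulgA mulgK.
Qed.

Lemma translate_diffs s ps g :
  translate s^-1 (diffs ps g) = diffs [seq (s p.1, s p.2) | p <- ps] (translate s^-1 g).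
Proof. by elim: ps => //= p ps <-; apply: translate_diff. Qed.

(** A permutation rearranging the family so that [p1, p2, p3] go to [p, q, r] transports both [g]
    and [x]; eigenspaces are invariant. *)
Lemma move_weight c g x p1 p2 p3 ps p q r : eig c g ->
  uniq (unpair [:: p1, p2, p3 & ps]) ->
  (forall w, w \in ps -> same x w.1 w.2) -> diffs [:: p1; p2; p3] g x != 0 ->
  {subset [:: p; q; r] <= [:: p1, p2, p3 & ps]} -> uniq [:: p; q; r] ->
  exists h z, [/\ eig c h, diffs [:: p; q; r] h z != 0 &
    forall w, w \in [:: p1, p2, p3 & ps] -> w \notin [:: p; q; r] -> same z w.1 w.2].
Proof.
set fam := [:: p1, p2, p3 & ps] => cg ufam xps gx sub upqr.
have [|||| rest perm_fam] := @perm_front3 _ fam p q r; rewrite ?sub ?inE ?eqxx ?orbT //.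
have ufam' : uniq (unpair [:: p, q, r & rest]) by rewrite -(perm_uniq (unpair_perm perm_fam)).
have [|s] := perm_map_uniq ufam ufam'.
  by rewrite !size_unpair (perm_size perm_fam).
rewrite unpair_map; set f := fun w : T * T => (s w.1, s w.2) => sE.
have {}sE : [seq f w | w <- fam] = [:: p, q, r & rest].
  by apply: unpair_inj; rewrite -sE /unpair -map_comp.
case: sE => sp sq sr srest.
exists (translate s^-1 g), (kact s x); split; first exact: eig_translate.
  rewrite -[[:: p; q; r]]/([:: p] ++ [:: q] ++ [:: r]).
  have -> : [:: p] ++ [:: q] ++ [:: r] = [seq f w | w <- [:: p1; p2; p3]] by rewrite /= sp sq sr.
  by rewrite -translate_diffs ffunE kactK.
move=> w; rewrite (perm_mem perm_fam) -[[:: p, q, r & rest]]/([:: p; q; r] ++ rest) mem_cat => /orP[->//|].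
rewrite -srest => /mapP[w' /xps xw' ->] _; by rewrite /f /= same_kact.
Qed.

Lemma related_pairs x (L : seq T) m : (1 < k)%N -> uniq L -> ((size L + 2 * m) * k <= #|T|)%N ->
  exists ps, [/\ size ps = m, uniq (L ++ unpair ps) & forall w, w \in ps -> same x w.1 w.2].
Proof.
move=> k1; elim: m L => [|m IHm] L uL kT.
  by exists [::]; rewrite cats0.
have [|v Lv] := @exists_unrelated T k x L; first by nia.
have [w wv xvw] := exists_related x v k1.
have vL : v \notin L by apply/negP => /Lv; rewrite same_refl.
have wL : w \notin L by apply/negP => /Lv; rewrite same_sym xvw.
have [||ps [sps ups xps]] := IHm (L ++ [:: v; w]).
- by rewrite cat_uniq uL /= inE (eq_sym v) wv orbF (negPf vL) (negPf wL).
- by rewrite size_cat /=; move: kT; congr (_ <= _)%N; congr (_ * _)%N; lia.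
exists ((v, w) :: ps); split; first by rewrite /= sps.
  by rewrite -catA in ups.
by move=> p; rewrite inE => /predU1P[->|/xps].
Qed.

(** The given transpositions are completed to a family of [3 * m] disjoint ones, the new ones being
    inside blocks of [x]. Moving the weight to [m ^ 3] triples of the family yields as many
    independent functionals on the eigenspace. *)
Lemma eig_weight3 (d : nat) c g x p1 p2 p3 m : c \is Num.real ->
  (forall x, #|orth x| = d) ->
  (1 < k)%N -> (6 * m * k <= #|T|)%N -> (0 < m)%N ->
  eig c g -> uniq (unpair [:: p1; p2; p3]) -> diffs [:: p1; p2; p3] g x != 0 ->
  (m ^ 3)%:R * c ^+ 2 <= (d * #|{: X}|)%:R.
Proof.
move=> cr deg k1 mT m0 cg u123 gx.
have [|ps [sps ups xps]] := @related_pairs x (unpair [:: p1; p2; p3]) (3 * m.-1) k1 u123.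
  by apply: leq_trans mT; rewrite size_unpair leq_mul2r; apply/orP; right; case: m m0 => //= n _; lia.
set fam := [:: p1, p2, p3 & ps].
have ufam : uniq (unpair fam) by [].
have sfam : size fam = (3 * m)%N by rewrite /= sps; rewrite /=; lia.
pose I := ('I_m * 'I_m * 'I_m)%type.
(* The [n]-th member of a triple has position congruent to [n] modulo 3, so members are distinct and
   the set of members determines the index. *)
pose pr (i : I) (n : nat) := nth p1 fam (3 * (if n is 0 then i.1.1 else if n is 1 then i.1.2 else i.2) + n).
pose trip i := [:: pr i 0%N; pr i 1%N; pr i 2].
have lt_idx (i : 'I_m) n : (n < 3)%N -> (3 * i + n < size fam)%N.
  by rewrite sfam => n3; have := ltn_ord i; lia.
have pr_in i n : (n < 3)%N -> pr i n \in fam.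
  by case: n => [|[|[|n]]] // _; apply: mem_nth; apply: lt_idx.
have ufam1 := unpair_uniq ufam.
have trip_sub i : {subset trip i <= fam}.
  by move=> w; rewrite !inE => /or3P[] /eqP->; apply: pr_in.
have trip_uniq i : uniq (trip i).
  by rewrite /= !inE !negb_or !nth_uniq ?lt_idx //; apply/and3P; split=> //; [apply/andP; split|]; apply/eqP; lia.
have trip_inj i j : {subset trip i <= trip j} -> i = j.
  case: i j => -[i1 i2] i3 [[j1 j2] j3] sub.
  have key n : (n < 3)%N -> pr (i1, i2, i3) n \in trip (j1, j2, j3) by case: n => [|[|[|n]]] // _; apply: sub; rewrite !inE eqxx ?orbT.
  have := (key 0%N isT, key 1%N isT, key 2%N isT).
  rewrite !inE !nth_uniq ?lt_idx //= => -[[k0 k1'] k2].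
  by congr (_, _, _); apply: ord_inj; lia.
have /fin_all_exists[gx_ gxP] : forall i : I, exists hz : fn * X, [/\ eig c hz.1, diffs (trip i) hz.1 hz.2 != 0 &
    forall w, w \in fam -> w \notin trip i -> same hz.2 w.1 w.2].
  move=> i; have [h [z hz]] := move_weight cg ufam xps gx (trip_sub i) (trip_uniq i).
  by exists (h, z).
pose delta z : fn := [ffun y => (y == z)%:R].
(* Pairing with [phi i] evaluates [diffs (trip i)] at the chosen partition; passing to the adjoint
   reverses the order of the factors. *)
pose phi i : fn := diffs (rev (trip i)) (delta (gx_ i).2).
have phiE i h : \sum_y phi i y * h y = diffs (trip i) h (gx_ i).2.
  rewrite /phi /diffs /= !diff_adjoint (bigD1 (gx_ i).2) //= ffunE eqxx mul1r.
  by rewrite big1 ?addr0 // => y /negPf yz; rewrite ffunE yz mul0r.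
have := @eigenspace_dim X (@orth T k) (@orth_sym T k) I c phi cr.
rewrite !card_prod !card_ord; have -> : (m * m * m = m ^ 3)%N by rewrite !expnS expn0 muln1 mulnA.
rewrite (eq_bigr (fun=> d)) ?sum_nat_const 1?mulnC //; apply.
(* Distinct triples have distinct weights under the involutions of the family:
   evaluating the relation at [diffs (trip i) _] leaves only the term of [i]. *)
move=> w wP i; have [gi gx0 xi] := gxP i.
have := wP (diffs (trip i) (gx_ i).1) (eig_diffs _ gi).
rewrite (bigD1 i) //= [X in _ + X]big1 => [|j ji].
  rewrite addr0 phiE (diffs3_square ufam) ?ffunMnE; last exact: trip_sub.
  by move/eqP; rewrite mulf_eq0 mulrn_eq0 /= (negPf gx0) orbF => /eqP.
rewrite phiE -[diffp _ (diffp _ (diffp _ _))]/(diffs (trip i) (gx_ i).1) -diffs_cat.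
(* The partition chosen for [j] has the two points of [v] together, so a difference along [v]
   vanishes there. *)
have /subsetPn[v vi vj] : ~~ (trip i \subset trip j).
  by apply: contra ji => /subsetP/trip_inj ->.
rewrite (@diffs_front _ ufam v) ?mem_cat ?vi ?orbT //; last first.
  by move=> u; rewrite mem_cat => /orP[] /trip_sub.
rewrite diffp_same ?mulr0 //; have [_ _] := gxP j; apply=> //; exact: trip_sub vi.
Qed.

End CaseA.

(** * The theorem *)

Section LeastEigenvalue.
Import Order.TTheory GRing.Theory Num.Theory.
Local Open Scope ring_scope.

(** A nonzero triple difference gives [m ^ 3 * c ^ 2 <= m ^ 3 * e ^ 2], so [c] is at least [- e];
    otherwise [c] is [- e] or a degree. *)
Lemma least_eigenvalue (T : finType) (k m d e : nat) (c : algC) (g : {ffun kpart T k -> algC}) :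
  (1 < k)%N -> (5 * k <= #|T|)%N -> (0 < m)%N -> (6 * m * k <= #|T|)%N ->
  (forall x : kpart T k, #|orth x| = d) ->
  (forall (x : kpart T k) i j, i != j -> ~~ same x i j -> #|[pred z | orth x z && same z i j]| = e) ->
  (d * #|{: kpart T k}| <= m ^ 3 * e ^ 2)%N ->
  eigfun (@orth T k) c g -> g != 0 -> c \is Num.real -> - e%:R <= c.
Proof.
move=> k1 kT m0 mT degd dege dX cg g0 cr.
have kill_or : (forall g i j u v p q, eigfun (@orth T k) c g -> uniq [:: i; j; u; v; p; q] ->
      diff i j (diff u v (diff p q g)) = 0) \/ c ^+ 2 <= e%:R ^+ 2.
  have [le|nle] := boolP (c ^+ 2 <= e%:R ^+ 2); [by right|left].
  move=> h i j u v p q ch uijk; apply: contraNeq nle => h0.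
  have [x hx] : exists x, diff i j (diff u v (diff p q h)) x != 0.
    apply/existsP; apply: contraNT h0; rewrite negb_exists => /forallP h0.
    by apply/eqP/ffunP=> x; rewrite [RHS]ffunE; apply/eqP; have := h0 x; rewrite negbK.
  have := @eig_weight3 T k d c h x (i, j) (u, v) (p, q) m cr degd k1 mT m0 ch uijk hx.
  move=> H; have m3 : 0 < (m ^ 3)%:R :> algC by rewrite ltr0n expn_gt0 m0.
  rewrite -(ler_pM2l m3); apply: le_trans H _.
  by rewrite -natrX -natrM ler_nat.
case: kill_or => [kill|].
  case: (eig_killed k1 kT dege cg g0 kill) => [->//|[x ->]].
  by apply: le_trans (ler0n _ _); rewrite oppr_le0 ler0n.
rewrite -[c ^+ 2]real_normK // ler_sqr ?nnegrE ?ler0n ?normr_ge0 //.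
by rewrite real_ler_norml // => /andP[].
Qed.

End LeastEigenvalue.

Definition orth_const (k : nat) := 2 * (1 + 2 * k ^ 2) ^ (4 * k ^ 2).
(* With [m = l %/ 6], so that [l <= 12 * m], this ensures
   [orth_const k * (k * l) ^ 2 <= m ^ 3]. *)
Definition threshold (k : nat) := 6 * (144 * orth_const k * k ^ 2).

(** From [e * (#|T| - k) = d * k.-1] follows [e * #|T|.-1 = (d + e) * k.-1], so the ratio bound
    [e / (d + e)] is [k.-1 / #|T|.-1], the proportion of partitions joining [i] and [j]. *)
Lemma intersecting_le_star (T : finType) (k l : nat) (F : {set kpart T k}) (i j : T) :
  1 < k -> #|T| = k * l -> threshold k <= l -> i != j ->
  {in F &, forall x y, ~~ orth x y} -> #|F| <= #|[pred z : kpart T k | same z i j]|.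
Proof.
move=> k1 Tkl thr ij Fint.
have [->|[x0 _]] := set_0Vmem F; first by rewrite cards0.
set C := orth_const k in thr.
have C2 : 2 <= C by rewrite /C /orth_const -[leqLHS]muln1 leq_mul2l expn_gt0.
rewrite /threshold -/C in thr.
pose m := l %/ 6.
have lm : l <= 6 * m + 5 by rewrite /m; lia.
have ml : 6 * m <= l by rewrite /m; lia.
have mC : 144 * C * k ^ 2 <= m by rewrite /m leq_divRL // mulnC.
have k2 : 4 <= k ^ 2 by nia.
have m1000 : 144 * 8 <= m by nia.
have lk : 4 * k <= l by nia.
have kT : 5 * k <= #|T| by rewrite Tkl; nia.
have kT4 : 4 * k ^ 2 <= #|T| by rewrite Tkl; nia.
have mT : 6 * m * k <= #|T| by rewrite Tkl; nia.
pose d := #|orth x0|.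
have degd (x : kpart T k) : #|orth x| = d by apply: card_orth.
have [b xib] : exists b, forall u, u \in [:: i] -> ~~ same x0 u b.
  by apply: exists_unrelated; rewrite mul1n (leq_trans _ kT) //; lia.
have {}xib : ~~ same x0 i b by apply: xib; rewrite inE.
have ib : i != b by apply: contraNneq xib => ->; apply: same_refl.
pose e := #|[pred z | orth x0 z && same z i b]|.
have dege (x : kpart T k) u v : u != v -> ~~ same x u v -> #|[pred z | orth x z && same z u v]| = e.
  by move=> uv xuv; apply: card_orth_same.
have ed : e * (#|T| - k) = d * k.-1 := card_orth_star xib.
have Xd : #|{: kpart T k}| <= C * d by apply: card_orth_lower => //; lia.
have Td : C * (#|T| - k) ^ 2 <= m ^ 3.
  have l12 : l <= 12 * m by lia.
  have tk : (#|T| - k) ^ 2 <= k ^ 2 * 144 * m ^ 2.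
    rewrite -mulnA -[144]/(12 ^ 2) -!expnMn leq_exp2r // Tkl.
    by apply: leq_trans (leq_subr _ _) _; rewrite leq_mul2l l12 orbT.
  apply: leq_trans (leq_mul (leqnn C) tk) _.
  rewrite (_ : _ * _ = 144 * C * k ^ 2 * m ^ 2); last by lia.
  by rewrite (expnS m) leq_mul2r mC orbT.
(* Multiplying by [(#|T| - k) ^ 2] turns [e] into [d * k.-1], after which [Xd] and [Td] suffice. *)
have dX : d * #|{: kpart T k}| <= m ^ 3 * e ^ 2.
  have Tk0 : 0 < #|T| - k by lia.
  rewrite -(@leq_pmul2r ((#|T| - k) ^ 2)) ?expn_gt0 ?Tk0 //.
  rewrite -[leqRHS]mulnA -expnMn ed.
  apply: (@leq_trans (d * (C * d) * (#|T| - k) ^ 2)); first by rewrite leq_mul2r leq_mul2l Xd !orbT.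
  apply: (@leq_trans (d ^ 2 * m ^ 3)); first by rewrite (_ : _ * _ = d ^ 2 * (C * (#|T| - k) ^ 2)) ?leq_mul2l ?Td ?orbT //; lia.
  rewrite mulnC leq_mul2l expnMn leq_pmulr ?orbT // expn_gt0; lia.
have least := @least_eigenvalue T k m d e.
have ratio : #|F| * (d + e) <= e * #|{: kpart T k}|.
  apply: (ratio_bound (@orth_sym T k)) => // c g cg g0 cr.
  by apply: (least c g) => //; lia.
have star := @card_same_star T k i j ij.
have d0 : 0 < d.
  rewrite lt0n; apply/eqP => d0; move: Xd; rewrite d0 muln0 leqn0 => /eqP/card0_eq/(_ x0).
  by rewrite inE.
have T1 : 0 < #|T|.-1 by lia.
rewrite -(@leq_pmul2r #|T|.-1) // star.
rewrite -(@leq_pmul2r (d + e)) ?addn_gt0 ?d0 //.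
have E : e * #|T|.-1 = (d + e) * k.-1.
  rewrite mulnDl -ed -mulnDr; congr (_ * _); lia.
rewrite mulnAC; apply: (@leq_trans (e * #|{: kpart T k}| * #|T|.-1)).
  by rewrite leq_mul2r ratio orbT.
by rewrite mulnAC E; lia.
Qed.

(** * The number of partitions with a given pair together *)

Section StarCount.

Definition kparts_on (T : finType) (D : {set T}) (k : nat) : {set {set {set T}}} :=
  [set P | partition P D && [forall B in P, #|B| == k]].

Lemma card_kparts_on (T U : finType) (D : {set T}) (k : nat) :
  #|D| = #|U| -> #|kparts_on D k| = #|kparts U k|.
Proof.
move=> DU; pose f (u : U) : T := enum_val (cast_ord (esym DU) (enum_rank u)).
have f_inj : injective f by move=> u v /enum_val_inj/cast_ord_inj/enum_rank_inj.
have fD : f @: [set: U] = D.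
  apply/eqP; rewrite eqEcard card_imset // cardsT DU leqnn andbT.
  by apply/subsetP=> _ /imsetP[u _ ->]; apply: enum_valP.
pose F (P : {set {set U}}) := [set f @: (B : {set U}) | B in P].
have F_inj : injective F by apply: imset_inj; apply: imset_inj.
rewrite -(card_imset _ F_inj); apply: eq_card => P; apply/idP/imsetP => [|[Q + ->]]; last first.
  rewrite !inE => /andP[Qp /forall_inP Qk]; rewrite -fD imset_partition // Qp.
  by apply/forall_inP=> _ /imsetP[B QB ->]; rewrite card_imset // Qk.
rewrite inE => /andP[Pp /forall_inP Pk].
have fK B : B \in P -> f @: (f @^-1: B) = B.
  move=> PB; apply/setP=> v; apply/imsetP/idP => [[u + ->]|vB]; first by rewrite inE.
  have : v \in D by apply: subsetP (partitionS Pp PB) _ vB.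
  by rewrite -fD => /imsetP[u _ vE]; exists u; rewrite // inE -vE.
have PE : P = F [set f @^-1: (B : {set T}) | B in P].
  apply/setP=> B; apply/idP/imsetP => [PB|[_ /imsetP[A PA ->] ->]].
    by exists (f @^-1: B); rewrite ?imset_f ?fK.
  by rewrite fK.
exists [set f @^-1: (B : {set T}) | B in P] => //; rewrite inE.
rewrite -(imset_partition _ _ f_inj) -/(F _) -PE fD Pp.
apply/forall_inP=> _ /imsetP[B PB ->].
by rewrite -(card_imset _ f_inj) fK // Pk.
Qed.

Lemma card_kparts_block (T U : finType) (k : nat) (B : {set T}) :
  0 < k -> #|B| = k -> #|T| = #|U| + k ->
  #|[set P in kparts T k | B \in P]| = #|kparts U k|.
Proof.
move=> k0 Bk TU; rewrite -(@card_kparts_on T U (~: B)); last by rewrite cardsCs setCK Bk TU addnK.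
have B0 : B != set0 by rewrite -card_gt0 Bk.
apply: (@bij_card_set _ _ _ _ (fun P : {set {set T}} => P :\ B) (fun P => B |: P)) => P; rewrite ?inE.
- move=> /andP[/andP[Pp /forall_inP Pk] PB]; rewrite -setTD partitionD1 //.
  by apply/forall_inP=> A /setD1P[_ /Pk].
- move=> /andP[Pp /forall_inP Pk]; rewrite eqxx andbT.
  have -> : [set: T] = B :|: ~: B by rewrite setUCr.
  rewrite partitionU1 //; last by rewrite -setI_eq0 setICr.
  by apply/forall_inP=> A /setU1P[->|/Pk]; rewrite ?Bk.
- by move=> /andP[_ PB]; rewrite setD1K.
- move=> /andP[Pp _]; rewrite setU1K //; apply: contra B0 => PB.
  by have := partitionS Pp PB; rewrite -disjoints_subset -setI_eq0 setIid.
Qed.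

Lemma card_sets_pair (T : finType) (k : nat) (i j : T) : i != j -> 1 < k ->
  #|[set B : {set T} | [&& #|B| == k, i \in B & j \in B]]| = 'C(#|T| - 2, k - 2).
Proof.
move=> ij k1; have c2 : #|[set i; j]| = 2 by rewrite cards2 ij.
have -> : #|T| - 2 = #|~: [set i; j]| by rewrite [RHS]cardsCs setCK c2.
rewrite -cards_draws.
apply: (@bij_card_set _ _ _ _ (fun B : {set T} => B :\: [set i; j]) (fun A => A :|: [set i; j])) => B; rewrite !inE.
- move=> /and3P[/eqP Bk iB jB]; rewrite setDE subsetIr -setDE cardsD.
  have /setIidPr -> : [set i; j] \subset B by apply/subsetP=> v; rewrite !inE => /pred2P[]->.
  by rewrite c2 Bk eqxx.
- move=> /andP[sB /eqP Bk]; rewrite !eqxx !orbT !andbT cardsU c2.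
  suff -> : B :&: [set i; j] = set0 by rewrite cards0 Bk; lia.
  by apply/eqP; rewrite setI_eq0 disjoints_subset.
- move=> /and3P[_ iB jB]; apply/setP=> v; rewrite !inE.
  case: (eqVneq v i) => [->|_] /=; first by rewrite iB.
  by case: (eqVneq v j) => [->|_] /=; rewrite ?jB ?orbF.
- move=> /andP[sB _]; apply/setP=> v; rewrite !inE.
  have [vB|_] := boolP (v \in B); last by rewrite /= andNb.
  by have := subsetP sB _ vB; rewrite !inE => ->.
Qed.

(** A partition joining [i] and [j] has exactly one block containing both. There are
    ['C(#|T| - 2, k - 2)] candidates for that block, and the rest is a partition of its
    complement. *)
Lemma card_star (T U : finType) (k : nat) (i j : T) : i != j -> 1 < k -> #|T| = #|U| + k ->
  #|[pred z : kpart T k | same z i j]| = 'C(#|T| - 2, k - 2) * #|kparts U k|.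
Proof.
move=> ij k1 TU; rewrite -(card_sets_pair ij k1).
have k0 : 0 < k by apply: ltnW.
have := double_count (fun B : {set T} => [&& #|B| == k, i \in B & j \in B])
          (fun z : kpart T k => true) (fun B z => B \in val z).
rewrite (eq_bigr (fun=> #|kparts U k|)) => [|B /and3P[/eqP Bk _ _]]; last first.
  rewrite -(card_kparts_block k0 Bk TU) -(card_imset _ val_inj).
  apply: eq_card => P; rewrite inE; apply/imsetP/andP => [[z + ->]|[Pk PB]].
    by rewrite inE /=; split; first exact: valP.
  by exists (Sub (P : {set {set T}}) Pk).
rewrite sum_nat_const -cardsE => ->.
rewrite -sum1_card big_mkcond; apply: eq_bigr => z _; rewrite inE.
case: ifPn => zij.
  apply/esym/eqP/card1P; exists (pblock (val z) i) => B; rewrite !inE.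
  apply/idP/eqP => [/andP[/and3P[_ iB _] zB]|->].
    by rewrite (def_pblock (partition_trivIset (kpart_partition z)) zB iB).
  by rewrite kpart_block (kpart_uniform (kpart_block z i)) eqxx -/(same z i j) zij -/(same z i i) same_refl.
apply/esym/eq_card0 => B; rewrite !inE; apply/negP => /andP[/and3P[_ iB jB] zB].
by case/negP: zij; apply/same_memP; exists B; rewrite ?iB.
Qed.

End StarCount.

(** Blocks of size [k] covering [k * l] points are [l] in number. *)
Lemma kl_partitionsE (k l : nat) : 0 < k -> kl_partitions k l = kparts 'I_(k * l) k.
Proof.
move=> k0; apply/setP=> P; rewrite !inE /is_kl_partition.
apply/and3P/andP => [[-> _ ->]//|[Pp /[dup] Pk /forall_inP Pk']]; split=> //.
have := card_uniform_partition (fun B PB => eqP (Pk' B PB)) Pp.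
by rewrite cardsT card_ord => kl; rewrite -(eqn_pmul2r k0) -kl mulnC.
Qed.

Lemma partially_2_intersecting_orth (T : finType) (k : nat) (x y : kpart T k) :
  partially_2_intersecting (val x) (val y) = ~~ orth x y.
Proof.
apply/exists_inP/idP => [[B xB /exists_inP[C yC]]|].
  case/card_gt1P=> i [j [/setIP[iB iC] /setIP[jB jC] ij]].
  apply/negP => /orthP/(_ i j ij) xy.
  have /xy/negP[] : same x i j by apply/same_memP; exists B; rewrite ?iB.
  by apply/same_memP; exists C; rewrite ?iC.
case/forallPn => i /forallPn[j]; rewrite negb_imply negbK => /and3P[ij /same_memP[B xB /andP[iB jB]] /same_memP[C yC /andP[iC jC]]].
exists B => //; apply/exists_inP; exists C => //.
by apply/card_gt1P; exists i, j; rewrite !inE iB jB iC jC.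
Qed.

Theorem theorem6p1 (k : nat) (hk : 3 <= k) :
  exists l0 : nat, forall l : nat, 0 < l -> l0 <= l ->
    \max_(F : {set {set {set 'I_(k * l)}}} | partially_2_intersecting_set F) #|F|
    = 'C(k * l - 2, k - 2) * num_kl_partitions k (l - 1).
Proof.
have k0 : 0 < k by lia.
have k1 : 1 < k by lia.
exists (threshold k) => l l0 kl.
have kl2 : 1 < k * l by nia.
pose i : 'I_(k * l) := Ordinal (ltnW kl2); pose j : 'I_(k * l) := Ordinal kl2.
have ij : i != j by [].
have TU : #|'I_(k * l)| = #|'I_(k * (l - 1))| + k by rewrite !card_ord; nia.
have star := card_star ij k1 TU.
rewrite card_ord -kl_partitionsE // -/(num_kl_partitions k (l - 1)) in star.
rewrite -star; apply/eqP; rewrite eqn_leq; apply/andP; split.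
  apply/bigmax_leqP => F /andP[/subsetP Fk /forall_inP Fint].
  pose G := [set z : kpart 'I_(k * l) k | val z \in F].
  have -> : #|F| = #|G|.
    rewrite -[RHS](card_imset _ val_inj); apply: eq_card => P; apply/idP/imsetP => [FP|[z + ->]]; last by rewrite inE.
    have Pk : P \in kparts 'I_(k * l) k by rewrite -kl_partitionsE // Fk.
    by exists (Sub P Pk); rewrite ?inE.
  apply: intersecting_le_star kl ij _ => //; first by rewrite card_ord.
  move=> x y; rewrite !inE => Fx Fy; rewrite -partially_2_intersecting_orth.
  exact: (forall_inP (Fint _ Fx)) Fy.
(* The bound is attained by the star of all partitions joining the points 0 and 1. *)
pose S : {set {set {set 'I_(k * l)}}} := [set val z | z in [pred z : kpart 'I_(k * l) k | same z i j]].
have -> : #|[pred z : kpart 'I_(k * l) k | same z i j]| = #|S|.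
  by rewrite card_imset //; apply: val_inj.
suff SP : partially_2_intersecting_set S by apply: (bigop.bigmax_sup S).
apply/andP; split.
  by apply/subsetP=> _ /imsetP[z _ ->]; rewrite kl_partitionsE //; apply: valP.
apply/forall_inP=> _ /imsetP[x + ->]; rewrite inE => xij.
apply/forall_inP=> _ /imsetP[y + ->]; rewrite inE => yij.
rewrite partially_2_intersecting_orth; apply/negP => /orthP/(_ _ _ ij xij).
by rewrite yij.
Qed.
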